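(* Fix $h\in(0,1]$ and $\Delta t>0$ and consider the Galerkin Euler--Maruyama scheme $$X_h^{j+1}=\bigl(R(\Delta t A_h)+r_{\mathrm d}^{-1}(\Delta t A_h)\,\Delta t\,P_hF\bigr)X_h^j+r_{\mathrm d}^{-1}(\Delta t A_h)P_hG(X_h^j)\Delta L^j,\qquad j\in\mathbb{N}_0,\quad X_h^0=P_hX_0 .$$ 1. (Backward Euler scheme) Let $R(z)=(1-z)^{-1}$ (with $r_{\mathrm n}(z)=1$, $r_{\mathrm d}(z)=1-z$). Then the zero solution of the scheme is asymptotically mean-square stable if $$\frac{(1+\Delta t\|F\|_{L(H)})^2+\Delta t\,\mathrm{Tr}(Q)\,\|G\|_{L(H;L(U;H))}^2}{(1+\Delta t\lambda_{h,1})^2}<1.$$ 2. (Crank--Nicolson scheme) Let $R(z)=(1+z/2)/(1-z/2)$ (with $r_{\mathrm n}(z)=1+z/2$, $r_{\mathrm d}(z)=1-z/2$). Then the zero solution of the scheme is asymptotically mean-square stable if $$\left(\max_{k\in\{1,N_h\}}\left|\frac{1-\Delta t\lambda_{h,k}/2}{1+\Delta t\lambda_{h,k}/2}\right|+\Delta t\frac{\|F\|_{L(H)}}{1+\Delta t\lambda_{h,1}/2}\right)^2+\Delta t\frac{\mathrm{Tr}(Q)\,\|G\|_{L(H;L(U;H))}^2}{(1+\Delta t\lambda_{h,1}/2)^2}<1.$$ 3. (Forward Euler scheme) Let $R(z)=1+z$ (with $r_{\mathrm n}(z)=1+z$, $r_{\mathrm d}(z)=1$). Then the zero solution of the scheme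 is asymptotically mean-square stable if $$\Bigl(\max_{\ell\in\{1,N_h\}}|1-\Delta t\lambda_{h,\ell}|+\Delta t\|F\|_{L(H)}\Bigr)^2+\Delta t\,\mathrm{Tr}(Q)\,\|G\|_{L(H;L(U;H))}^2<1.$$
   Context: $(\Omega,\mathcal{A},(\mathcal{F}_t)_{t\ge0},P)$ is a complete filtered probability space satisfying the usual conditions; $H$ and $U$ are real separable Hilbert spaces. $-A:\mathcal{D}(-A)\subset H\to H$ is densely defined, self-adjoint and positive definite with compact inverse; $F\in L(H)$; $G\in L(H;L(U;H))$, i.e. $G$ is bounded and linear from $H$ to the bounded linear operators $U\to H$, with operator norms. $X_0\in L^2(\Omega;H)$ is $\mathcal{F}_0$-measurable. $L$ is a $U$-valued square-integrable $Q$-L\'evy process with respect to $(\mathcal{F}_t)$ (adapted, $L(t)-L(s)$ independent of $\mathcal{F}_s$ for $s<t$) that is a martingale; its covariance operator $Q\in L(U)$ is self-adjoint, positive semidefinite and of trace class. $t_j=j\Delta t$ and $\Delta L^j=L(t_{j+1})-L(t_j)$. $\dot H^1=\mathcal{D}((-A)^{1/2})$ with inner product $\langle\cdot,\cdot\rangle_1=\langle(-A)^{1/2}\cdot,(-A)^{1/2}\cdot\rangle_H$. $V_h\subset\dot H^1\subset H$ is a subspace of finite dimension $N_h$, with the norm of $H$; $P_h$ is the $H$-orthogonal projection onto $V_h$; $-A_h:V_h\to V_h$ is defined by $\langle-A_hv,w\rangle_H=\langle v,w\rangle_1$ for all $v,w\in V_h$. It is self-adjoint and positive definite, with eigenvalues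 $0<\lambda_{h,1}\le\dots\le\lambda_{h,N_h}$ and corresponding $H$-orthonormal eigenvectors $e_{h,1},\dots,e_{h,N_h}$. For $R=r_{\mathrm n}/r_{\mathrm d}$ with polynomials $r_{\mathrm n},r_{\mathrm d}$, $$R(\Delta tA_h)v=\sum_{k=1}^{N_h}\frac{r_{\mathrm n}(-\Delta t\lambda_{h,k})}{r_{\mathrm d}(-\Delta t\lambda_{h,k})}\langle v,e_{h,k}\rangle_He_{h,k},\qquad r_{\mathrm d}^{-1}(\Delta tA_h)v=\sum_{k=1}^{N_h}\frac{1}{r_{\mathrm d}(-\Delta t\lambda_{h,k})}\langle v,e_{h,k}\rangle_He_{h,k}.$$ The zero solution of the scheme is $X_{h,\mathrm e}^j=0$ for all $j$. It is mean-square stable if for every $\varepsilon>0$ there is $\delta>0$ such that $\mathbb{E}[\|X_h^j\|_H^2]<\varepsilon$ for all $j\in\mathbb{N}_0$ whenever ($X_h^0\in L^2(\Omega;V_h)$ is $\mathcal{F}_0$-measurable and) $\mathbb{E}[\|X_h^0\|_H^2]<\delta$. It is asymptotically mean-square stable if it is mean-square stable and there is $\delta>0$ such that $\mathbb{E}[\|X_h^0\|_H^2]<\delta$ implies $\lim_{j\to\infty}\mathbb{E}[\|X_h^j\|_H^2]=0$. *)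

(* Defs.v *)
From HB Require Import structures.
From mathcomp Require Import all_boot all_order all_algebra.
From mathcomp Require Import all_classical all_reals all_analysis.
Set Implicit Arguments.
Unset Strict Implicit.
Unset Printing Implicit Defensive.
Import Order.TTheory GRing.Theory Num.Theory.
Import numFieldNormedType.Exports.
Local Open Scope classical_set_scope.
Local Open Scope ring_scope.

(* A real Hilbert space is a completeNormedModType H together with a form
   ip : {dot H for idfun} (real inner product) inducing the norm of H. *)
Definition induces_norm (R : realType) (H : normedModType R)
    (ip : H -> H -> R) : Prop :=
  forall x, `|x| ^+ 2 = ip x x.

Definition separable_space (T : topologicalType) : Prop :=
  exists2 D : set T, countable D & dense D.

Definition lin_span (R : realType) (H : lmodType R) (S : set H) : set H :=
  [set x | exists (n : nat) (c : 'I_n -> R) (u : 'I_n -> H),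
     (forall i, S (u i)) /\ x = \sum_(i < n) c i *: u i].

Definition orthonormal_basis (R : realType) (U : normedModType R)
    (ip : U -> U -> R) (B : set U) : Prop :=
  [/\ forall u, B u -> ip u u = 1,
      forall u v, B u -> B v -> u <> v -> ip u v = 0
    & dense (lin_span B)].

Section operators.
Variable R : realType.

Definition opnorm (V W : normedModType R) (f : V -> W) : R :=
  sup [set `|f x| | x in [set x : V | `|x| <= 1]].

(* Norm of L(V; L(U; W)); an element is encoded as a bilinear G : V -> U -> W. *)
Definition opnorm2 (V U W : normedModType R) (G : V -> U -> W) : R :=
  sup [set opnorm (G x) | x in [set x : V | `|x| <= 1]].

Definition bounded_into_operators (V U W : normedModType R)
    (G : V -> U -> W) : Prop :=
  (forall x, continuous (G x)) /\
  exists C : R, forall x, opnorm (G x) <= C * `|x|.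

Variables (H : normedModType R) (ip : H -> H -> R).

Definition self_adjoint (Q : H -> H) : Prop :=
  forall u v, ip (Q u) v = ip u (Q v).

Definition pos_semidef (Q : H -> H) : Prop := forall u, 0 <= ip (Q u) u.

(* The trace series of a positive semidefinite operator along an orthonormal
   basis B; it does not depend on B. *)
Definition trace_class (B : set H) (Q : H -> H) : Prop :=
  (\esum_(u in B) (ip (Q u) u)%:E < +oo)%E.

Definition trace (B : set H) (Q : H -> H) : R :=
  fine (\esum_(u in B) (ip (Q u) u)%:E)%E.

(* An unbounded operator is a domain D and a map T : H -> H, whose values
   outside D are irrelevant. *)
Definition linear_on (D : set H) (T : H -> H) : Prop :=
  D 0 /\ forall (a : R) x y, D x -> D y ->
    D (a *: x + y) /\ T (a *: x + y) = a *: T x + T y.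

(* Equality of the graphs of the adjoint of (D, T) and of (D, T): y is in the
   domain of the adjoint, with image z, iff <T x, y> = <x, z> for all x in D. *)
Definition self_adjoint_on (D : set H) (T : H -> H) : Prop :=
  forall y z, (forall x, D x -> ip (T x) y = ip x z) <-> (D y /\ T y = z).

Definition pos_def_on (D : set H) (T : H -> H) : Prop :=
  forall x, D x -> x != 0 -> 0 < ip (T x) x.

Definition compact_operator (S : H -> H) : Prop :=
  compact (closure (S @` [set x : H | `|x| <= 1])).

Definition has_compact_inverse (D : set H) (T : H -> H) : Prop :=
  exists S : {linear H -> H},
    [/\ forall x, D (S x), forall x, T (S x) = x,
        forall x, D x -> S (T x) = x & compact_operator S].

(* (DB, B) is the nonnegative self-adjoint square root of (D, T): the graph of
   B \o B on its natural domain is the graph of T on D. *)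
Definition is_sqrt_of (D : set H) (T : H -> H) (DB : set H) (B : H -> H) :
    Prop :=
  [/\ linear_on DB B, dense DB, self_adjoint_on DB B,
      forall x, DB x -> 0 <= ip (B x) x
    & forall x y, (D x /\ T x = y) <-> [/\ DB x, DB (B x) & B (B x) = y]].

Definition is_orth_proj (V : set H) (P : H -> H) : Prop :=
  forall x, V (P x) /\ forall w, V w -> ip (x - P x) w = 0.

(* negAh is the operator V -> V with <negAh v, w> = <B v, B w> for v, w in V. *)
Definition is_galerkin_operator (B : H -> H) (V : set H) (negAh : H -> H) :
    Prop :=
  (forall v, V v -> V (negAh v)) /\
  forall v w, V v -> V w -> ip (negAh v) w = ip (B v) (B w).

(* The spectral data e_0, ..., e_n and lam_0 <= ... <= lam_n of negAh on V;
   in particular V is a subspace of dimension n.+1. *)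
Definition is_eigenbasis (V : set H) (negAh : H -> H) (n : nat)
    (lam : 'I_n.+1 -> R) (e : 'I_n.+1 -> H) : Prop :=
  [/\ V = lin_span (range e),
      forall k l, ip (e k) (e l) = (k == l)%:R,
      forall k l : 'I_n.+1, (k <= l)%N -> lam k <= lam l
    & forall k, negAh (e k) = lam k *: e k].

(* (p / q)(dt * A_h), where the eigenvalues of dt * A_h are - dt * lam k. *)
Definition ratop (n : nat) (lam : 'I_n.+1 -> R) (e : 'I_n.+1 -> H) (dt : R)
    (p q : {poly R}) (v : H) : H :=
  \sum_(k < n.+1)
    (p.[- (dt * lam k)] / q.[- (dt * lam k)] * ip v (e k)) *: e k.

End operators.

Section probability.
Context {d : measure_display} {T : measurableType d} {R : realType}.
Variable P : probability T R.

Definition is_filtration (Fil : R -> set (set T)) : Prop :=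
  (forall t, 0 <= t ->
     sigma_algebra setT (Fil t) /\ (Fil t `<=` @measurable d T)) /\
  (forall s t, 0 <= s -> s <= t -> Fil s `<=` Fil t).

Definition usual_conditions (Fil : R -> set (set T)) : Prop :=
  (forall N, P.-negligible N -> Fil 0 N) /\
  (forall t, 0 <= t -> Fil t = \bigcap_(s in [set s | t < s]) Fil s).

Section random_variables.
Variables (H : normedModType R) (ip : H -> H -> R).

(* Measurability of X from (T, G) to H with its Borel sigma-algebra. *)
Definition meas_wrt (G : set (set T)) (X : T -> H) : Prop :=
  forall B, <<s @open H >> B -> G (X @^-1` B).

Definition second_moment (X : T -> H) : \bar R :=
  ('E_P[(fun w => (`|X w| ^+ 2)%R)])%E.

Definition in_L2 (G : set (set T)) (X : T -> H) : Prop :=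
  meas_wrt G X /\ (second_moment X < +oo)%E.

Definition indep_of (G : set (set T)) (X : T -> H) : Prop :=
  forall A B, G A -> <<s @open H >> B ->
    P (A `&` X @^-1` B) = (P A * P (X @^-1` B))%E.

(* Y = E[X | G]; the Bochner integrals over A in G are compared through the
   functionals ip _ u, which characterize them. *)
Definition is_cond_exp (G : set (set T)) (X Y : T -> H) : Prop :=
  [/\ meas_wrt G Y,
      P.-integrable setT (fun w => (`|X w|)%:E),
      P.-integrable setT (fun w => (`|Y w|)%:E)
    & forall A u, G A ->
        (\int[P]_(w in A) (ip (X w) u)%:E = \int[P]_(w in A) (ip (Y w) u)%:E)%E].

Definition is_martingale (Fil : R -> set (set T)) (M : R -> T -> H) : Prop :=
  forall s t, 0 <= s -> s <= t -> is_cond_exp (Fil s) (M t) (M s).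

Definition is_levy_process (Fil : R -> set (set T)) (L : R -> T -> H) : Prop :=
  [/\ {ae P, forall w, L 0 w = 0},
      forall t, 0 <= t -> meas_wrt (Fil t) (L t),
      forall s t, 0 <= s -> s < t ->
        indep_of (Fil s) (fun w => L t w - L s w),
      forall s t r B, 0 <= s -> s <= t -> 0 <= r -> <<s @open H >> B ->
        P ((fun w => L (t + r) w - L (s + r) w) @^-1` B) =
        P ((fun w => L t w - L s w) @^-1` B)
    & forall t eps, 0 <= t -> 0 < eps ->
        P [set w | eps < `|L s w - L t w|]
          @[s --> within [set s | 0 <= s] (nbhs t)] --> 0%E].

Definition has_covariance (L : R -> T -> H) (Q : H -> H) : Prop :=
  forall s t u v, 0 <= s -> 0 <= t ->
    ('E_P[(fun w => (ip (L t w) u * ip (L s w) v)%R)] =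
     (Num.min t s * ip (Q u) v)%:E)%E.

Definition is_Q_levy_martingale (Fil : R -> set (set T)) (L : R -> T -> H)
    (Q : H -> H) : Prop :=
  [/\ is_levy_process Fil L,
      forall t, 0 <= t -> (second_moment (L t) < +oo)%E,
      is_martingale Fil L & has_covariance L Q].

(* Stability of the zero solution of a scheme S, given as the map sending X_0
   to the sequence (X^j)_j.  X_0 ranges over the F_0-measurable elements of
   L^2(Omega; H); for a Galerkin scheme, where X^0 = P_h X_0, the initial
   values X^0 then range over the F_0-measurable elements of L^2(Omega; V_h). *)
Definition mean_square_stable (F0 : set (set T))
    (S : (T -> H) -> nat -> T -> H) : Prop :=
  forall eps : R, 0 < eps -> exists2 delta : R, 0 < delta &
    forall X0, in_L2 F0 X0 ->
      (second_moment (S X0 0%N) < delta%:E)%E ->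
      forall j, (second_moment (S X0 j) < eps%:E)%E.

Definition asymptotically_mean_square_stable (F0 : set (set T))
    (S : (T -> H) -> nat -> T -> H) : Prop :=
  mean_square_stable F0 S /\
  exists2 delta : R, 0 < delta &
    forall X0, in_L2 F0 X0 ->
      (second_moment (S X0 0%N) < delta%:E)%E ->
      second_moment (S X0 j) @[j --> \oo] --> 0%E.

End random_variables.

Fixpoint galerkin_euler_maruyama (H U : normedModType R) (ip : H -> H -> R)
    (n : nat) (lam : 'I_n.+1 -> R) (e : 'I_n.+1 -> H) (Ph F : H -> H)
    (G : H -> U -> H) (L : R -> T -> U) (dt : R) (rn rd : {poly R})
    (X0 : T -> H) (j : nat) (w : T) : H :=
  match j with
  | 0%N => Ph (X0 w)
  | i.+1 =>
      let X := galerkin_euler_maruyama ip lam e Ph F G L dt rn rd X0 i w in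
      let dL := L (i.+1%:R * dt) w - L (i%:R * dt) w in
      ratop ip lam e dt rn rd X
      + ratop ip lam e dt 1 rd (dt *: Ph (F X))
      + ratop ip lam e dt 1 rd (Ph (G X dL))
  end.

End probability.

(* Main.v *)
(* The drift part of one step, Phi = R(dt A_h) + dt r_d^-1(dt A_h) P_h F, has
   norm at most alpha = m + dt M |F|, where m and M bound the values of R and of
   1 / r_d at the eigenvalues.  The noise part is at most M |G| |X| |dL|
   pointwise.  Since X^j is F_(t_j)-measurable and dL is independent of F_(t_j),
   E[|X|^2 |dL|^2] = E|X|^2 E|dL|^2, and the cross term has mean zero because
   <G(e_k) dL, e_l> is a centred functional of dL.  With E|dL|^2 <= dt Tr Q this
   gives E|X^(j+1)|^2 <= (alpha^2 + dt Tr(Q) |G|^2 M^2) E|X^j|^2, a geometric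
   decay under the hypotheses.  Both facts about dL are obtained from an
   enumeration of the orthonormal basis by dominated convergence, so that
   neither the Riesz theorem nor a square root of Q is used. *)
Require Import Defs.
From HB Require Import structures.
From mathcomp Require Import all_boot all_order all_algebra.
From mathcomp Require Import all_classical all_reals all_analysis.
From mathcomp Require Import measurable_realfun ring lra.
Set Implicit Arguments.
Unset Strict Implicit.
Unset Printing Implicit Defensive.
Import Order.TTheory GRing.Theory Num.Theory.
Import numFieldNormedType.Exports.
Local Open Scope classical_set_scope.
Local Open Scope ring_scope.

(** * Real inner products: Cauchy--Schwarz, Bessel and Parseval *)

Section inner_product.
Variables (R : realType) (H : normedModType R) (ip : {dot H for idfun}).
Hypothesis hip : induces_norm ip.

Lemma ip_sym u v : ip u v = ip v u.
Proof. by rewrite hermC expr0 mul1r. Qed.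

Lemma ip_suml (I : finType) (f : I -> H) v :
  ip (\sum_i f i) v = \sum_i ip (f i) v.
Proof. by rewrite linear_sumlz. Qed.

Lemma ip_scalel a u v : ip (a *: u) v = a * ip u v.
Proof. by rewrite linearZl_LR. Qed.

Lemma ip_scaler a u v : ip u (a *: v) = a * ip u v.
Proof. by rewrite ip_sym ip_scalel ip_sym. Qed.

Lemma ip_addl u v w : ip (u + v) w = ip u w + ip v w.
Proof. by rewrite linearDl. Qed.

Lemma normD_sqr u v : `|u + v| ^+ 2 = `|u| ^+ 2 + 2 * ip u v + `|v| ^+ 2.
Proof.
rewrite !hip linearDl !linearDr /= (ip_sym v u); ring.
Qed.

Lemma cauchy_schwarz u v : `|ip u v| <= `|u| * `|v|.
Proof.
have [->|v0] := eqVneq v 0; first by rewrite linear0r !normr0 mulr0.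
have vp : 0 < `|v| ^+ 2 by rewrite exprn_gt0 ?normr_gt0.
(* This vector is [|v|^2] times the component of [u] orthogonal to [v]; its squared norm is
   [|v|^2 (|u|^2 |v|^2 - <u,v>^2)]. *)
have := sqr_ge0 `|(`|v| ^+ 2) *: u - ip u v *: v|.
rewrite -[- (_ *: v)]scaleNr normD_sqr ip_scalel !normrZ !exprMn.
rewrite ip_scaler !real_normK ?num_real//.
rewrite (_ : _ + _ = `|v| ^+ 2 * (`|u| ^+ 2 * `|v| ^+ 2 - ip u v ^+ 2)); last by ring.
rewrite pmulr_rge0// subr_ge0 => h.
by rewrite -ler_sqr ?nnegrE ?mulr_ge0// exprMn real_normK ?num_real.
Qed.

Lemma ip_continuous u : continuous (fun v => ip v u : R).
Proof.
move=> v; apply/cvgrPdist_lt => eps eps0.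
(* The added 1 keeps the divisor positive when [u = 0]. *)
have k0 : 0 < `|u| + 1 by rewrite ltr_wpDl.
near=> w.
rewrite -linearBl; apply: le_lt_trans (cauchy_schwarz _ _) _.
apply: (@le_lt_trans _ _ (`|v - w| * (`|u| + 1))).
  by rewrite ler_wpM2l// lerDl.
rewrite -ltr_pdivlMr//; near: w.
by apply: cvgr_dist_lt; rewrite ?divr_gt0//; exact: cvg_id.
Unshelve. all: by end_near. Qed.

Section orthonormal_family.
Variables (I : finType) (c : I -> H).
(* Zero entries are allowed, so that a finite basis can be listed along nat. *)
Hypothesis c_orth : forall i j, i != j -> ip (c i) (c j) = 0.
Hypothesis c_norm : forall i, c i = 0 \/ ip (c i) (c i) = 1.

Lemma ip_family (a : I -> R) j :
  ip (\sum_i a i *: c i) (c j) = a j * ip (c j) (c j).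
Proof.
rewrite ip_suml (bigD1 j)//= ip_scalel big1 ?addr0// => i ij.
by rewrite ip_scalel c_orth ?mulr0.
Qed.

Lemma norm_family (a : I -> R) :
  `|\sum_i a i *: c i| ^+ 2 = \sum_i a i ^+ 2 * ip (c i) (c i).
Proof.
rewrite hip ip_suml; apply: eq_bigr => i _.
by rewrite ip_scalel ip_sym ip_family mulrA expr2.
Qed.

(** The orthogonal projection onto the span of [c] once [c_orth] and [c_norm] hold; zero entries
    contribute nothing. *)
Definition family_proj v := \sum_i ip v (c i) *: c i.

Lemma family_proj_sub v j : ip (v - family_proj v) (c j) = 0.
Proof.
rewrite linearBl /= ip_family; have [->|->] := c_norm j.
  by rewrite !linear0r subr0.
by rewrite mulr1 subrr.
Qed.

Lemma norm_family_proj v : `|family_proj v| ^+ 2 = \sum_i ip v (c i) ^+ 2.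
Proof.
rewrite norm_family; apply: eq_bigr => i _; have [->|->] := c_norm i.
  by rewrite !linear0r expr0n.
by rewrite mulr1.
Qed.

(** Pythagoras: the residual [v - family_proj v] is orthogonal to every combination of the family.
    Hence the projection is the best approximation, and [a = 0] gives Bessel's identity. *)
Lemma norm_sub_family v (a : I -> R) :
  `|v - \sum_i a i *: c i| ^+ 2 =
  `|v - family_proj v| ^+ 2 + `|family_proj v - \sum_i a i *: c i| ^+ 2.
Proof.
rewrite -[X in `|X| ^+ 2 = _](subrKA (family_proj v)) normD_sqr.
suff -> : ip (v - family_proj v) (family_proj v - \sum_i a i *: c i) = 0.
  by rewrite mulr0 addr0.
rewrite [X in ip _ (X - _)]/family_proj -sumrB ip_sym ip_suml big1// => i _.
by rewrite -scalerBl ip_scalel [ip (c i) _]ip_sym family_proj_sub mulr0.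
Qed.

Lemma bessel_eq v :
  `|v| ^+ 2 = `|v - family_proj v| ^+ 2 + \sum_i ip v (c i) ^+ 2.
Proof.
have := norm_sub_family v (fun=> 0).
rewrite [X in v - X]big1; last by move=> i _; rewrite scale0r.
rewrite [X in family_proj v - X]big1; last by move=> i _; rewrite scale0r.
by rewrite !subr0 norm_family_proj.
Qed.

End orthonormal_family.

Section basis_sequence.
Variable c : nat -> H.
Hypothesis c_orth : forall i j, i != j -> ip (c i) (c j) = 0.
Hypothesis c_norm : forall i, c i = 0 \/ ip (c i) (c i) = 1.
Hypothesis c_total : forall v eps, 0 < eps ->
  exists N (a : 'I_N -> R), `|v - \sum_(i < N) a i *: c i| < eps.

Let cN N := fun i : 'I_N => c i.
Let cN_orth N (i j : 'I_N) : i != j -> ip (cN i) (cN j) = 0.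
Proof. by move=> ij; exact: c_orth. Qed.
Let cN_norm N (i : 'I_N) : cN i = 0 \/ ip (cN i) (cN i) = 1.
Proof. exact: c_norm. Qed.

Lemma bessel v N : \sum_(i < N) ip v (c i) ^+ 2 <= `|v| ^+ 2.
Proof. by rewrite (bessel_eq (@cN_orth N) (@cN_norm N)) lerDr sqr_ge0. Qed.

Lemma norm_partial_expansion v N :
  `|\sum_(i < N) ip v (c i) *: c i| <= `|v|.
Proof.
rewrite -ler_sqr ?nnegrE// -/(family_proj (@cN N) v).
by rewrite norm_family_proj; [exact: bessel | exact: cN_orth | exact: cN_norm].
Qed.

Lemma dist_expansion v N :
  `|v - \sum_(i < N) ip v (c i) *: c i| ^+ 2 =
  `|v| ^+ 2 - \sum_(i < N) ip v (c i) ^+ 2.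
Proof.
rewrite [`|v| ^+ 2](bessel_eq (@cN_orth N) (@cN_norm N)).
by rewrite /cN addrK.
Qed.

(** Totality supplies some combination of the first [N] entries within [eps] of [v]. The [N]-th
    partial expansion is at least as close, by best approximation, and the distance does not
    increase for longer expansions, by [dist_expansion]. *)
Lemma cvg_expansion v :
  (\sum_(i < N) ip v (c i) *: c i) @[N --> \oo] --> v.
Proof.
apply/cvgrPdist_lt => eps eps0.
have [N [a hN]] := c_total v eps0.
exists N => // M /= NM.
apply: le_lt_trans hN.
rewrite -ler_sqr ?nnegrE//.
apply: (@le_trans _ _ (`|v - \sum_(i < N) ip v (c i) *: c i| ^+ 2)).
  rewrite !dist_expansion lerB// -!(big_mkord xpredT (fun i => ip v (c i) ^+ 2)).
  by rewrite (big_cat_nat _ NM)//= lerDl sumr_ge0// => i _; exact: sqr_ge0.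
rewrite (norm_sub_family (@cN_orth N) (@cN_norm N) v a).
by rewrite lerDl sqr_ge0.
Qed.

Lemma parseval v :
  (\sum_(i < N) ip v (c i) ^+ 2) @[N --> \oo] --> `|v| ^+ 2.
Proof.
have : `|v - \sum_(i < N) ip v (c i) *: c i| ^+ 2 @[N --> \oo] --> (0 : R).
  have : (v - \sum_(i < N) ip v (c i) *: c i) @[N --> \oo] --> (0 : H).
    by have := cvgB (cvg_cst v) (@cvg_expansion v); rewrite subrr => hv; exact: hv.
  move=> /cvg_norm; rewrite normr0 => h.
  have := cvgM h h; rewrite mulr0 => h2.
  by under eq_fun do rewrite expr2; exact: h2.
move=> h; have := cvgB (cvg_cst (`|v| ^+ 2)) h; rewrite subr0.
suff -> : (fun=> `|v| ^+ 2) -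
    (fun N => `|v - \sum_(i < N) ip v (c i) *: c i| ^+ 2) =
    (fun N => \sum_(i < N) ip v (c i) ^+ 2).
  by move=> hv; exact: hv.
apply/funext => N.
transitivity (`|v| ^+ 2 - `|v - \sum_(i < N) ip v (c i) *: c i| ^+ 2) => //.
by rewrite dist_expansion subKr.
Qed.

End basis_sequence.
End inner_product.

(** * Enumeration of an orthonormal basis of a separable space *)

Section orthonormal_basis_sequence.
Variables (R : realType) (U : normedModType R) (ip : {dot U for idfun}).
Hypothesis hip : induces_norm ip.

(** Distinct basis vectors lie at distance [sqrt 2], so two of them cannot share a point of the
    countable dense set within [1/2]; choosing such a point is therefore injective on [b]. *)
Lemma orthonormal_countable (b : set U) : separable_space U ->
  orthonormal_basis ip b -> countable b.
Proof.
move=> [D cD dD] [b1 b0 _].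
have near_D u : exists d, D d /\ `|u - d| < 2^-1.
  have [d [ud Dd]] : (ball u (2^-1 : R) `&` D) !=set0.
    apply: dD; last exact: ball_open.
    by exists u; exact: ballxx.
  by exists d; split => //; move: ud; rewrite -ball_normE.
have [f hf] := choice near_D.
have [g ginj] := (countable_injP _ cD).
apply/countable_injP; exists (g \o f) => u v /set_mem bu /set_mem bv /= gfuv.
have fuv : f u = f v by apply: ginj => //; apply: mem_set; apply (hf _).1.
apply: contrapT => uv.
have : `|u - v| ^+ 2 = 2.
  rewrite (normD_sqr hip) normrN !hip !b1// -scaleN1r (ip_scaler ip) b0//; ring.
have : `|u - v| < 1.
  rewrite -(subrKA (f u)); apply: le_lt_trans (ler_normD _ _) _.
  rewrite {2}fuv [X in _ + X]distrC [ltRHS]splitr mul1r.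
  by apply: ltrD; exact: (hf _).2.
move=> h1 h2; have : `|u - v| ^+ 2 <= 1 by rewrite exprn_ile1// ltW.
by rewrite h2 leNgt ltr1n.
Qed.

(** The last clause is what links partial sums along [c] to the trace series, which is a sum over
    the set [b]. *)
Lemma orthonormal_basis_seq (b : set U) : separable_space U ->
  orthonormal_basis ip b ->
  exists c : nat -> U,
    [/\ forall i j, i != j -> ip (c i) (c j) = 0,
        forall i, c i = 0 \/ ip (c i) (c i) = 1,
        forall v eps, 0 < eps -> exists N (a : 'I_N -> R),
          `|v - \sum_(i < N) a i *: c i| < eps
      & forall (f : U -> \bar R) N, f 0 = 0%E -> (forall u, (0 <= f u)%E) ->
          (\sum_(i < N) f (c i) <= \esum_(u in b) f u)%E].
Proof.
move=> sepU hb; have [g ginj] := countable_injP _ (orthonormal_countable sepU hb).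
case: hb => b1 b0 bd.
(* The sequence inverts the injective coding [g]; an index that codes no basis vector receives the
   default 0. *)
pose c i := xget 0 [set u | b u /\ g u = i].
have cg u : b u -> c (g u) = u.
  move=> bu; rewrite /c; case: xgetP => [v _ [bv gvu]|/(_ u)]; last by case.
  by apply: ginj => //; exact: mem_set.
have cP i : c i = 0 \/ b (c i) /\ g (c i) = i.
  by rewrite {1 2 3}/c; case: xgetP => [v _ vP|_]; [right|left].
exists c; split.
- move=> i j ij.
  case: (cP i) => [->|[bi gi]]; first by rewrite linear0l.
  case: (cP j) => [->|[bj gj]]; first by rewrite linear0r.
  by apply: b0 => // cij; move: ij; rewrite -gi -gj cij eqxx.
- by move=> i; case: (cP i) => [->|[bi _]]; [left|right; exact: b1].
- move=> v eps eps0.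
  have [x [vx [n [k [u [bu xE]]]]]] : (ball v eps `&` lin_span b) !=set0.
    apply: bd; last exact: ball_open.
    by exists v; exact: ballxx.
  pose N := (\max_i g (u i)).+1.
  have gN i : (g (u i) < N)%N by rewrite ltnS; exact: leq_bigmax.
  (* The combination may list a basis vector several times, so coefficients with the same code are
     added. *)
  exists N, (fun m => \sum_(i | Ordinal (gN i) == m) k i).
  suff -> : \sum_(m < N) (\sum_(i | Ordinal (gN i) == m) k i) *: c m = x.
    by move: vx; rewrite -ball_normE.
  rewrite xE [RHS](partition_big (fun i => Ordinal (gN i)) xpredT)//=.
  apply: eq_bigr => m _; rewrite scaler_suml; apply: eq_bigr => i /eqP <-.
  by rewrite /= cg.
- move=> f N f0 fpos.
  rewrite -(big_mkord xpredT (fun i => f (c i))).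
  apply: le_trans (nneseries_lim_ge _ _) _ => //.
  rewrite nneseries_esumT//.
  (* Reindexing along [c] is injective here: a basis vector has norm 1, so it cannot be the default
     0. The remaining indices contribute [f 0 = 0]. *)
  have -> : \esum_(u in b) f u = \esum_(i in [set i | b (c i)]) f (c i).
    apply: reindex_esum; split => //.
      move=> i j /set_mem bi /set_mem bj cij.
      case: (cP i) => [ci0|[_ <-]].
        by have := b1 _ bi; rewrite ci0 linear0l => /eqP; rewrite eq_sym oner_eq0.
      case: (cP j) => [ci0|[_ <-]]; last by rewrite cij.
      by have := b1 _ bj; rewrite ci0 linear0l => /eqP; rewrite eq_sym oner_eq0.
    by move=> u bu; exists (g u); rewrite /= ?cg.
  rewrite [leRHS]esum_mkcond; apply: le_esum => i _.
  case: ifPn => // /negP nb; case: (cP i) => [->|[bi _]]; first by rewrite f0.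
  by exfalso; apply: nb; exact: mem_set.
Qed.

End orthonormal_basis_sequence.

(** * Operator norms of linear and bilinear maps *)

Section operator_norms.
Variables (R : realType) (V U W : normedModType R).

(** When [E] is empty or unbounded, [sup E] is 0 by convention. *)
Lemma sup_nneg_ge0 (E : set R) : (forall x, E x -> 0 <= x) -> 0 <= sup E.
Proof.
move=> E0; have [[[x Ex] ubE]|/sup_out ->//] := pselect (has_sup E).
exact: le_trans (E0 _ Ex) (ub_le_sup ubE Ex).
Qed.

Lemma opnorm_ge0 (X Y : normedModType R) (f : {linear X -> Y}) :
  0 <= opnorm f.
Proof.
apply: sup_nneg_ge0 => _ [x _ <-]; exact: normr_ge0.
Qed.

Lemma opnorm_has_ub (X Y : normedModType R) (f : {linear X -> Y}) :
  continuous f -> has_ubound [set `|f x| | x in [set x : X | `|x| <= 1]].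
Proof.
move=> /linear_bounded_continuous/linear_boundedP[M [_ hM]].
(* The bound holds for every constant above [M], hence [M + 1]; the maximum with 0 makes it monotone
   in [|x| <= 1]. *)
exists (Num.max 0 (M + 1)) => _ [x /= x1 <-].
apply: le_trans (hM (M + 1) _ x) _; first by rewrite ltrDl.
apply: (@le_trans _ _ (Num.max 0 (M + 1) * `|x|)).
  by rewrite ler_wpM2r// le_max lexx orbT.
by rewrite ler_piMr// le_max lexx.
Qed.

Lemma le_opnorm (X Y : normedModType R) (f : {linear X -> Y}) x :
  continuous f -> `|f x| <= opnorm f * `|x|.
Proof.
move=> cf; have [->|x0] := eqVneq x 0; first by rewrite linear0 !normr0 mulr0.
rewrite -ler_pdivrMr ?normr_gt0//.
apply: (ub_le_sup (opnorm_has_ub cf)).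
exists (`|x|^-1 *: x) => /=.
  by rewrite normrZ normfV normr_id mulVf ?normr_eq0.
by rewrite linearZ normrZ normfV normr_id mulrC.
Qed.

Variable G : {bilinear V -> U -> W}.
Hypothesis hG : bounded_into_operators G.

Lemma opnorm2_ge0 : 0 <= opnorm2 G.
Proof. apply: sup_nneg_ge0 => _ [x _ <-]; exact: opnorm_ge0. Qed.

Lemma le_opnorm2 x u : `|G x u| <= opnorm2 G * `|x| * `|u|.
Proof.
have [->|x0] := eqVneq x 0.
  by rewrite linear0l !normr0 mulr0 mul0r.
have [cG [C hC]] := hG.
pose y := `|x|^-1 *: x.
have y1 : `|y| <= 1 by rewrite normrZ normfV normr_id mulVf ?normr_eq0.
have -> : G x u = `|x| *: G y u.
  by rewrite -linearZl_LR scalerA divff ?normr_eq0// scale1r.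
rewrite normrZ normr_id [leRHS]mulrAC [leRHS]mulrC ler_wpM2l//.
apply: (le_trans (le_opnorm u (cG y))); rewrite ler_wpM2r//.
apply: ub_le_sup; last by exists y.
(* The constant [C] carries no sign, hence its absolute value. *)
exists `|C| => _ [z /= z1 <-]; apply: le_trans (hC z) _.
apply: (@le_trans _ _ (`|C| * `|z|)); first by rewrite ler_wpM2r// ler_norm.
by rewrite ler_piMr.
Qed.

End operator_norms.

(** * Product formula for independent integrable real variables *)

Section independent_product.
Context d (T : measurableType d) (R : realType) (P : probability T R).
Variables f g : {mfun T >-> R}.
Hypothesis fg_indep : forall A B, measurable A -> measurable B ->
  (P (f @^-1` A `&` g @^-1` B) = P (f @^-1` A) * P (g @^-1` B))%E.
Hypothesis f_int : P.-integrable setT (EFin \o f).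
Hypothesis g_int : P.-integrable setT (EFin \o g).

Let h w := (f w, g w).
Let mh : measurable_fun setT h.
Proof. exact: measurable_fun_pair. Qed.
Let hM : {mfun T >-> (R * R)%type} := HB.pack h (isMeasurableFun.Build _ _ _ _ h mh).
Let m1 := distribution P f.
Let m2 := distribution P g.

(** Independence says that the two measures agree on rectangles, which determine the product
    measure. *)
Let joint_law (A : set (R * R)) : measurable A ->
  distribution P hM A = (m1 \x m2)%E A.
Proof.
by move=> mA; apply/esym; apply: product_measure_unique.
Qed.

Let mul_meas : measurable_fun setT (EFin \o (fun z : R * R => z.1 * z.2)).
Proof. by apply/measurable_EFinP; exact: measurable_funM. Qed.

Let integral_joint_law (F : R * R -> \bar R) :
  (\int[distribution P hM]_z F z = \int[(m1 \x m2)%E]_z F z)%E.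
Proof. by apply: eq_measure_integral => A mA _; exact: joint_law. Qed.

Let f_int_law : m1.-integrable setT EFin.
Proof. by apply: integrable_pushforward. Qed.

Let g_int_law : m2.-integrable setT EFin.
Proof. by apply: integrable_pushforward. Qed.

Let abs_meas : measurable_fun setT (fun x : R => `|x|%:E).
Proof. by apply/measurable_EFinP; exact: normr_measurable. Qed.

(** By Tonelli the integral of [|x y|] is the product of the two first absolute moments, both
    finite. *)
Let mul_int : (m1 \x m2)%E.-integrable setT (fun z => (z.1 * z.2)%:E).
Proof.
apply/integrable12ltyP => //=.
have [_ m1f] := (integrableP _ _ _ f_int_law).
have [_ m2f] := (integrableP _ _ _ g_int_law).
have absM x : (\int[m2]_y `|(x * y)%:E| = `|x|%:E * \int[m2]_y `|y|%:E)%E.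
  under eq_integral => y _ do rewrite abse_EFin normrM EFinM.
  by rewrite ge0_integralZl.
under eq_integral => x _ do rewrite absM.
rewrite ge0_integralZr//; last by apply: integral_ge0 => y _; rewrite lee_fin.
by rewrite lte_mul_pinfty ?integral_ge0// ge0_fin_numE ?integral_ge0.
Qed.

Lemma independent_integrableM : P.-integrable setT (fun w => (f w * g w)%:E).
Proof.
apply/integrableP; split.
  by apply/measurable_EFinP; exact: measurable_funM.
have [_] := (integrableP _ _ _ mul_int); rewrite -integral_joint_law.
by rewrite ge0_integral_distribution//; exact: measurableT_comp.
Qed.

(** The expectation is transported to the joint law, which is the product of the marginals; Fubini
    then pulls [x] out of the inner integral. *)
Lemma independent_integralM :
  (\int[P]_w (f w * g w)%:E = (\int[P]_w (f w)%:E) * (\int[P]_w (g w)%:E))%E.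
Proof.
transitivity (\int[distribution P hM]_z (z.1 * z.2)%:E)%E.
  by rewrite integral_distribution//; exact: independent_integrableM.
rewrite integral_joint_law -integral12_prod_meas1//.
rewrite -(@integral_distribution _ _ _ _ _ P f EFin)//.
rewrite -(@integral_distribution _ _ _ _ _ P g EFin)//.
have mulM x : fubini_F m2 (fun z : R * R => (z.1 * z.2)%:E) x =
    (x%:E * \int[m2]_y y%:E)%E.
  by rewrite /fubini_F /=; under eq_integral do rewrite EFinM; rewrite integralZl.
under eq_integral do rewrite mulM.
by rewrite -(fineK (integrable_fin_num _ g_int_law))// integralZr.
Qed.

End independent_product.

(** * Real functions measurable for a sub-sigma-algebra *)

Section real_measurability.
Context d (T : measurableType d) (R : realType).

Definition real_meas_wrt (G : set (set T)) (f : T -> R) :=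
  forall B, measurable B -> G (f @^-1` B).

Variable G : set (set T).
Hypothesis sG : sigma_algebra setT G.

(** Equips [T] with [G] as its measurable structure, so that the closure properties of
    [measurable_fun] apply to members of a filtration. *)
Let real_meas_wrtE (f : T -> R) :
  real_meas_wrt G f <-> measurable_fun setT (f : g_sigma_algebraType G -> R).
Proof.
have E : G.-sigma.-measurable = G by exact: measurable_g_measurableTypeE.
split=> [fG _ B mB|mf B mB]; first by rewrite setTI E; exact: fG.
by have := mf measurableT B mB; rewrite setTI E.
Qed.

Lemma real_meas_wrt_cst (r : R) : real_meas_wrt G (fun=> r).
Proof. by apply/real_meas_wrtE; exact: measurable_cst. Qed.

Lemma real_meas_wrtD (f g : T -> R) :
  real_meas_wrt G f -> real_meas_wrt G g -> real_meas_wrt G (fun w => f w + g w).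
Proof.
move=> /real_meas_wrtE mf /real_meas_wrtE mg.
by apply/real_meas_wrtE; exact: measurable_funD.
Qed.

Lemma real_meas_wrtB (f g : T -> R) :
  real_meas_wrt G f -> real_meas_wrt G g -> real_meas_wrt G (fun w => f w - g w).
Proof.
move=> /real_meas_wrtE mf /real_meas_wrtE mg.
by apply/real_meas_wrtE; exact: measurable_funB.
Qed.

Lemma real_meas_wrtM (f g : T -> R) :
  real_meas_wrt G f -> real_meas_wrt G g -> real_meas_wrt G (fun w => f w * g w).
Proof.
move=> /real_meas_wrtE mf /real_meas_wrtE mg.
by apply/real_meas_wrtE; exact: measurable_funM.
Qed.

Lemma real_meas_wrt_sum (I : finType) (f : I -> T -> R) :
  (forall i, real_meas_wrt G (f i)) -> real_meas_wrt G (fun w => \sum_i f i w).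
Proof.
move=> mf; apply/real_meas_wrtE; apply: measurable_sum => i.
exact/real_meas_wrtE.
Qed.

End real_measurability.

Lemma real_meas_wrt_measurable d (T : measurableType d) (R : realType)
    (G : set (set T)) (f : T -> R) :
  G `<=` measurable -> real_meas_wrt G f -> measurable_fun setT f.
Proof. by move=> GT fG _ B mB; rewrite setTI; apply: GT; exact: fG. Qed.

Lemma continuous_borel (R : realType) (H : normedModType R) (phi : H -> R) B :
  continuous phi -> measurable B -> <<s @open H >> (phi @^-1` B).
Proof.
move=> cphi mB.
suff : measurable_fun setT (phi : g_sigma_algebraType (@open H) -> R).
  by move=> /(_ measurableT B mB); rewrite setTI.
(* It suffices to test open intervals, whose preimages are open. *)
apply: (@measurability _ _ _ _ _ _ (@RGenOpens.G R)).
  exact: RGenOpens.measurableE.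
move=> _ [_ [x [y ->]] <-]; rewrite setTI.
apply: sub_sigma_algebra; apply: (open_comp (fun z _ => cphi z)).
exact: interval_open.
Qed.

Lemma meas_wrt_comp d (T : measurableType d) (R : realType)
    (H : normedModType R) (G : set (set T)) (X : T -> H) (phi : H -> R) :
  meas_wrt G X -> continuous phi -> real_meas_wrt G (phi \o X).
Proof.
by move=> mX cphi B mB; rewrite comp_preimage; apply: mX; exact: continuous_borel.
Qed.

(** * Integrability, dominated convergence and independence for real expectations *)

Section expectations.
Context d (T : measurableType d) (R : realType) (P : probability T R).

Lemma integrable_dominated (f g : T -> R) : measurable_fun setT f ->
  P.-integrable setT (EFin \o g) -> (forall w, `|f w| <= g w) ->
  P.-integrable setT (EFin \o f).
Proof.
move=> mf ig fg; apply: (le_integrable _ _ _ ig) => //.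
  exact/measurable_EFinP.
by move=> w _ /=; rewrite lee_fin (le_trans (fg w))// ler_norm.
Qed.

Lemma integrable_addR (f g : T -> R) :
  P.-integrable setT (EFin \o f) -> P.-integrable setT (EFin \o g) ->
  P.-integrable setT (EFin \o (fun w => f w + g w)).
Proof.
by move=> fi gi; apply: eq_integrable (integrableD measurableT fi gi).
Qed.

Lemma integrable_scaleR (k : R) (f : T -> R) :
  P.-integrable setT (EFin \o f) ->
  P.-integrable setT (EFin \o (fun w => k * f w)).
Proof.
by move=> fi; apply: eq_integrable (integrableZl measurableT k fi).
Qed.

Lemma integrable_subR (f g : T -> R) :
  P.-integrable setT (EFin \o f) -> P.-integrable setT (EFin \o g) ->
  P.-integrable setT (EFin \o (fun w => f w - g w)).
Proof.
by move=> fi gi; apply: eq_integrable (integrableB measurableT fi gi).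
Qed.

Lemma integrable_sumR (I : finType) (f : I -> T -> R) :
  (forall i, P.-integrable setT (EFin \o f i)) ->
  P.-integrable setT (EFin \o (fun w => \sum_i f i w)).
Proof.
move=> fi; have := @integrable_sum _ _ _ P setT measurableT I (index_enum I)
  xpredT (fun i => EFin \o f i) (fun i _ => fi i).
by apply: eq_integrable => // w _ /=; rewrite -sumEFin.
Qed.

Lemma Rintegral_sum (I : finType) (f : I -> T -> R) :
  (forall i, P.-integrable setT (EFin \o f i)) ->
  \int[P]_w (\sum_i f i w) = \sum_i \int[P]_w f i w.
Proof.
move=> fi; rewrite /Rintegral.
under eq_integral do rewrite -sumEFin.
rewrite (@integral_sum _ _ _ P setT measurableT I (fun i => EFin \o f i))//.
rewrite -(sum_fine (index_enum I) (F := fun i => \int[P]_w (f i w)%:E)%E)//.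
by move=> i _; exact: (integrable_fin_num measurableT (fi i)).
Qed.

Lemma Rintegral_EFin (f : T -> R) : P.-integrable setT (EFin \o f) ->
  (\int[P]_w (f w)%:E = (\int[P]_w f w)%:E)%E.
Proof. by move=> fi; rewrite fineK//; exact: (integrable_fin_num measurableT fi). Qed.

Lemma Rintegral_dominated_cvg (f_ : nat -> T -> R) (f g : T -> R) :
  (forall n, measurable_fun setT (f_ n)) -> measurable_fun setT f ->
  (forall w, f_ n w @[n --> \oo] --> f w) ->
  P.-integrable setT (EFin \o g) -> (forall n w, `|f_ n w| <= g w) ->
  \int[P]_w f_ n w @[n --> \oo] --> \int[P]_w f w.
Proof.
move=> mf_ mf cf gi fg.
have fi_ n := integrable_dominated (mf_ n) gi (fg n).
have [|||||fi _] := @dominated_convergence _ _ _ P setT measurableT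
  (fun n => EFin \o f_ n) (EFin \o f) (EFin \o g).
- by move=> n; exact/measurable_EFinP.
- exact/measurable_EFinP.
- by apply: aeW => w _; apply/cvg_EFin; [exact: nearW|exact: cf].
- exact: gi.
- by apply: aeW => w n _; rewrite /= lee_fin.
rewrite -(fineK (integrable_fin_num measurableT fi)).
by move=> /fine_cvg; apply.
Qed.

Lemma integrable_second_moment (H : normedModType R) (X : T -> H) :
  measurable_fun setT (fun w => `|X w| ^+ 2) -> (second_moment P X < +oo)%E ->
  P.-integrable setT (EFin \o (fun w => `|X w| ^+ 2)).
Proof.
move=> mX; rewrite /second_moment unlock => X2.
apply/integrableP; split; first exact/measurable_EFinP.
by under eq_integral do rewrite /= ger0_norm ?sqr_ge0//.
Qed.

Lemma second_momentE (H : normedModType R) (X : T -> H) :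
  P.-integrable setT (EFin \o (fun w => `|X w| ^+ 2)) ->
  second_moment P X = (\int[P]_w `|X w| ^+ 2)%:E.
Proof. by move=> iX; rewrite /second_moment unlock Rintegral_EFin. Qed.

(** The product of norms is at most the sum of their squares. The second space [K] is separate so
    that [Y] may be a real constant, which gives integrability of functionals of [X]. *)
Lemma integrable_sqr_dominated (H K : normedModType R) (X : T -> H) (Y : T -> K)
    (f : T -> R) : measurable_fun setT f ->
  P.-integrable setT (EFin \o (fun w => `|X w| ^+ 2)) ->
  P.-integrable setT (EFin \o (fun w => `|Y w| ^+ 2)) ->
  (forall w, `|f w| <= `|X w| * `|Y w|) ->
  P.-integrable setT (EFin \o f).
Proof.
move=> mf iX iY fXY.
apply: (integrable_dominated mf (integrable_addR iX iY)) => w.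
apply: le_trans (fXY w) _.
have := sqr_ge0 (`|X w| - `|Y w|); have := sqr_ge0 (`|X w|).
have := sqr_ge0 (`|Y w|); nra.
Qed.

(** Events [A] of the form [f^-1(B)] reduce independence of [g] from the whole of [G] to
    independence of [f] and [g]. *)
Lemma independent_expectationM (G : set (set T)) (f g : T -> R) :
  G `<=` measurable -> real_meas_wrt G f -> measurable_fun setT g ->
  (forall A B, G A -> measurable B ->
     P (A `&` g @^-1` B) = (P A * P (g @^-1` B))%E) ->
  P.-integrable setT (EFin \o f) -> P.-integrable setT (EFin \o g) ->
  P.-integrable setT (EFin \o (fun w => f w * g w)) /\
  \int[P]_w (f w * g w) = \int[P]_w f w * \int[P]_w g w.
Proof.
move=> GT fG mg fg fi gi.
have mf := real_meas_wrt_measurable GT fG.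
pose f' : {mfun T >-> R} := HB.pack f (isMeasurableFun.Build _ _ _ _ f mf).
pose g' : {mfun T >-> R} := HB.pack g (isMeasurableFun.Build _ _ _ _ g mg).
have ind A B : measurable A -> measurable B ->
    (P (f' @^-1` A `&` g' @^-1` B) = P (f' @^-1` A) * P (g' @^-1` B))%E.
  by move=> mA mB; apply: fg => //; exact: fG.
split; first exact: (independent_integrableM (f := f') (g := g')).
rewrite /Rintegral -fineM ?(integrable_fin_num measurableT)//.
by rewrite -(independent_integralM (f := f') (g := g') ind fi gi).
Qed.

End expectations.

Lemma norm_sqr_continuous (R : realType) (H : normedModType R) :
  continuous (fun u : H => `|u| ^+ 2).
Proof.
move=> u; rewrite /continuous_at expr2; under eq_fun do rewrite expr2.
by apply: cvgM; exact: norm_continuous.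
Qed.

(** * Independence, mean and second moment of a Levy increment *)

Section levy_increment.
Context (R : realType) d (T : measurableType d) (P : probability T R).
Variables (Fil : R -> set (set T)) (U : normedModType R).
Variables (ip : {dot U for idfun}) (Q : U -> U) (L : R -> T -> U) (b : set U).
Hypothesis hFil : is_filtration Fil.
Hypothesis hip : induces_norm ip.
Hypothesis sepU : separable_space U.
Hypothesis hQpos : pos_semidef ip Q.
Hypothesis hb : orthonormal_basis ip b.
Hypothesis hQtr : trace_class ip b Q.
Hypothesis hL : is_Q_levy_martingale P ip Fil L Q.
Variables s t : R.
Hypotheses (s0 : 0 <= s) (st : s < t).

Let D w := L t w - L s w.
Let t0 : 0 <= t := ltW (le_lt_trans s0 st).
Let sub_meas r : 0 <= r -> Fil r `<=` measurable := fun r0 => (hFil.1 r r0).2.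
Let L_meas r : 0 <= r -> meas_wrt (Fil r) (L r).
Proof. by case: hL => -[_ + _ _ _] _ _ _; exact. Qed.

Let L_sqr_int r : 0 <= r ->
  P.-integrable setT (EFin \o (fun w => `|L r w| ^+ 2)).
Proof.
move=> r0; apply: integrable_second_moment; last by case: hL => _ + _ _; exact.
apply: (real_meas_wrt_measurable (sub_meas r0)).
apply: (meas_wrt_comp (phi := fun u : U => `|u| ^+ 2) (L_meas r0)).
exact: norm_sqr_continuous.
Qed.

Lemma increment_indep (phi : U -> R) A B : continuous phi -> Fil s A ->
  measurable B ->
  P (A `&` (phi \o D) @^-1` B) = (P A * P ((phi \o D) @^-1` B))%E.
Proof.
case: hL => -[_ _ indep _ _] _ _ _ cphi sA mB.
by rewrite comp_preimage indep//; exact: continuous_borel.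
Qed.

(** Linearity turns the functional of the increment into a difference of two adapted real
    functions. *)
Lemma functional_increment_adapted (phi : {linear U -> R^o}) :
  continuous phi -> real_meas_wrt (Fil t) (phi \o D).
Proof.
move=> cphi; have sT := (hFil.1 t t0).1.
have -> : phi \o D = fun w => phi (L t w) - phi (L s w).
  by apply/funext => w /=; rewrite linearB.
apply: real_meas_wrtB => //; first exact: (meas_wrt_comp (L_meas t0) cphi).
move=> B mB; apply: (hFil.2 s t s0 (ltW st)).
exact: (meas_wrt_comp (L_meas s0) cphi).
Qed.

Let ip_adapted u r : 0 <= r -> real_meas_wrt (Fil r) (fun w => ip (L r w) u).
Proof.
move=> r0; apply: (meas_wrt_comp (phi := fun v => ip v u) (L_meas r0)).
exact: (ip_continuous hip).
Qed.

Let ip_meas u r : 0 <= r -> measurable_fun setT (fun w => ip (L r w) u).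
Proof.
by move=> r0; apply: (real_meas_wrt_measurable (sub_meas r0)); exact: ip_adapted.
Qed.

Let ipD_meas u : measurable_fun setT (fun w => ip (D w) u).
Proof.
under eq_fun do rewrite linearBl; apply: measurable_funB; exact: ip_meas.
Qed.

(** By Parseval the squared norm is a pointwise limit of finite sums of squared coordinates. *)
Lemma increment_norm_measurable : measurable_fun setT (fun w => `|D w| ^+ 2).
Proof.
have [c [c1 c2 c3 _]] := orthonormal_basis_seq hip sepU hb.
apply: (@measurable_fun_cvg _ _ _ _
  (fun N w => \sum_(i < N) ip (D w) (c i) ^+ 2)).
  move=> N; apply: measurable_sum => i; apply: measurable_funX; exact: ipD_meas.
by move=> w _; exact: (parseval hip c1 c2 c3).
Qed.

Lemma increment_sqr_integrable :
  P.-integrable setT (EFin \o (fun w => `|D w| ^+ 2)).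
Proof.
apply: (integrable_dominated increment_norm_measurable
  (g := fun w => 2 * (`|L t w| ^+ 2 + `|L s w| ^+ 2))).
  by apply/integrable_scaleR/integrable_addR; exact: L_sqr_int.
move=> w; rewrite ger0_norm ?sqr_ge0//.
have : `|D w| ^+ 2 <= (`|L t w| + `|L s w|) ^+ 2.
  by rewrite ler_sqr ?nnegrE ?addr_ge0// ler_normB.
have := sqr_ge0 (`|L t w| - `|L s w|); nra.
Qed.

Let ip_int u r : 0 <= r -> P.-integrable setT (EFin \o (fun w => ip (L r w) u)).
Proof.
move=> r0; apply: (integrable_sqr_dominated (K := R^o) (Y := fun=> `|u|)
  (ip_meas u r0) (L_sqr_int r0)).
  exact: (finite_measure_integrable_cst P (`| (`|u| : R^o) | ^+ 2)).
by move=> w; rewrite normr_id; exact: cauchy_schwarz.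
Qed.

Lemma ip_increment_mean u : \int[P]_w ip (D w) u = 0.
Proof.
under eq_Rintegral do rewrite linearBl.
rewrite RintegralB//; [|exact: ip_int..].
(* The martingale identity is tested on the whole space, which lies in [Fil s] as the complement of
   the empty set. *)
case: hL => _ _ hM _; have [_ _ _ /(_ setT u)] := hM s t s0 (ltW st).
rewrite /Rintegral => ->; first by rewrite subrr.
have [F0 FC _] := (hFil.1 s s0).1.
by rewrite -(setD0 setT); exact: FC.
Qed.

Let ipD_int u : P.-integrable setT (EFin \o (fun w => ip (D w) u)).
Proof.
under eq_fun do rewrite linearBl.
by apply: integrable_subR; exact: ip_int.
Qed.

Lemma functional_increment_integrable (phi : {linear U -> R^o}) :
  continuous phi -> P.-integrable setT (EFin \o (phi \o D)).
Proof.
move=> cphi; have mphi := real_meas_wrt_measurable (sub_meas t0)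
  (functional_increment_adapted cphi).
apply: (integrable_sqr_dominated (K := R^o) (Y := fun=> opnorm phi)
  mphi increment_sqr_integrable).
  exact: (finite_measure_integrable_cst P (`| (opnorm phi : R^o) | ^+ 2)).
move=> w /=; rewrite (ger0_norm (opnorm_ge0 phi)) mulrC; exact: le_opnorm.
Qed.

(** Along the basis, [phi] of a partial expansion of [D] is a finite combination of centred
    coordinates; continuity of [phi] and dominated convergence pass to the limit. *)
Lemma functional_increment_mean (phi : {linear U -> R^o}) :
  continuous phi -> \int[P]_w phi (D w) = 0.
Proof.
move=> cphi.
have [c [c1 c2 c3 _]] := orthonormal_basis_seq hip sepU hb.
have := @Rintegral_dominated_cvg _ _ _ P
  (fun N w => \sum_(i < N) phi (c i) * ip (D w) (c i)) (phi \o D)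
  (* Partial expansions have norm at most [|D|], and [|D| <= 1 + |D|^2] is integrable. *)
  (fun w => opnorm phi * (1 + `|D w| ^+ 2)).
have phiE N w : \sum_(i < N) phi (c i) * ip (D w) (c i) =
    phi (\sum_(i < N) ip (D w) (c i) *: c i).
  by rewrite linear_sum; apply: eq_bigr => i _; rewrite linearZ mulrC.
move=> /(_ _ _ _ _ _)/cvg_lim <- //.
- apply: lim_near_cst => //; apply: nearW => N.
  rewrite Rintegral_sum; last by move=> i; exact/integrable_scaleR/ipD_int.
  by apply: big1 => i _; rewrite RintegralZl ?ip_increment_mean ?mulr0//; exact: ipD_int.
- move=> N; apply: measurable_sum => i; apply: measurable_funM => //; exact: ipD_meas.
- exact: (real_meas_wrt_measurable (sub_meas t0) (functional_increment_adapted cphi)).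
- move=> w; under eq_fun do rewrite phiE.
  have := cvg_comp _ _ (@cvg_expansion _ _ _ hip _ c1 c2 c3 (D w)) (cphi (D w)).
  by move=> hc; exact: hc.
- apply/integrable_scaleR/integrable_addR; last exact: increment_sqr_integrable.
  exact: (finite_measure_integrable_cst P (1 : R)).
- move=> N w; rewrite phiE; apply: le_trans (le_opnorm _ cphi) _.
  rewrite ler_wpM2l ?opnorm_ge0//.
  apply: le_trans (norm_partial_expansion hip c1 c2 _ _) _.
  have := sqr_ge0 (`|D w| - 1); have := normr_ge0 (D w); nra.
Qed.

(** Expanding the square, the covariance formula yields the factor [t - 2 min(t,s) + s = t - s]. *)
Lemma ip_increment_sqr_mean u :
  \int[P]_w (ip (D w) u ^+ 2) = (t - s) * ip (Q u) u.
Proof.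
have ab_int r r' : 0 <= r -> 0 <= r' ->
    P.-integrable setT (EFin \o (fun w => ip (L r w) u * ip (L r' w) u)).
  move=> r0 r0'; apply: (integrable_dominated _
      (g := fun w => `|u| ^+ 2 * (`|L r w| ^+ 2 + `|L r' w| ^+ 2))).
  - by apply: measurable_funM; exact: ip_meas.
  - by apply/integrable_scaleR/integrable_addR; exact: L_sqr_int.
  - move=> w; rewrite normrM.
    apply: le_trans (ler_pM _ _ (cauchy_schwarz hip _ _) (cauchy_schwarz hip _ _)) _ => //.
    rewrite [leLHS](_ : _ = `|u| ^+ 2 * (`|L r w| * `|L r' w|)); last by ring.
    rewrite ler_wpM2l ?sqr_ge0//.
    have := sqr_ge0 (`|L r w| - `|L r' w|).
    by have := sqr_ge0 `|L r w|; have := sqr_ge0 `|L r' w|; nra.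
have ab_mean r r' : 0 <= r -> 0 <= r' ->
    \int[P]_w (ip (L r w) u * ip (L r' w) u) = Num.min r r' * ip (Q u) u.
  move=> r0 r0'; case: hL => _ _ _ /(_ r' r u u r0' r0).
  by rewrite unlock /Rintegral => ->.
transitivity (\int[P]_w (ip (L t w) u * ip (L t w) u
    + (-2) * (ip (L t w) u * ip (L s w) u) + ip (L s w) u * ip (L s w) u)).
  by apply: eq_Rintegral => w _; rewrite linearBl /=; ring.
rewrite !RintegralD ?RintegralZl ?ab_mean//; try exact: ab_int.
- by rewrite !minxx (min_r (ltW st)); ring.
- exact/integrable_scaleR/ab_int.
- by apply/integrable_addR; [exact: ab_int|exact/integrable_scaleR/ab_int].
Qed.

(** The truncated Parseval sums have mean [(t - s)] times a partial sum of the trace series. By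
    Bessel they are dominated by [|D|^2] itself, so the bound survives the limit. *)
Lemma increment_sqr_mean :
  \int[P]_w (`|D w| ^+ 2) <= (t - s) * trace ip b Q.
Proof.
have [c [c1 c2 c3 c4]] := orthonormal_basis_seq hip sepU hb.
have sqr_meas u : measurable_fun setT (fun w => ip (D w) u ^+ 2).
  by apply: measurable_funX; exact: ipD_meas.
have := @Rintegral_dominated_cvg _ _ _ P
  (fun N w => \sum_(i < N) ip (D w) (c i) ^+ 2) (fun w => `|D w| ^+ 2)
  (fun w => `|D w| ^+ 2).
have meanE N : \int[P]_w (\sum_(i < N) ip (D w) (c i) ^+ 2) =
    \sum_(i < N) (t - s) * ip (Q (c i)) (c i).
  rewrite Rintegral_sum; first by apply: eq_bigr => i _; exact: ip_increment_sqr_mean.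
  move=> i; apply: (integrable_sqr_dominated (sqr_meas _)
    increment_sqr_integrable increment_sqr_integrable) => w.
  (* A zero entry gives a zero coordinate; otherwise [c i] is a unit vector and Cauchy--Schwarz
     bounds both factors by [|D|]. *)
  have [ci0|ci1] := c2 i.
    by rewrite ci0 linear0r expr0n normr0 mulr_ge0.
  rewrite normrX expr2; apply: ler_pM => //.
    apply: le_trans (cauchy_schwarz hip _ _) _.
    suff -> : `|c i| = 1 by rewrite mulr1.
    by apply/eqP; rewrite -sqrp_eq1// hip ci1.
  apply: le_trans (cauchy_schwarz hip _ _) _.
  suff -> : `|c i| = 1 by rewrite mulr1.
  by apply/eqP; rewrite -sqrp_eq1// hip ci1.
move=> /(_ _ _ _ _ _) cvgD.
have {}cvgD := cvgD (fun N => measurable_sum _ (fun i => sqr_meas _))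
  increment_norm_measurable (fun w => parseval hip c1 c2 c3 (v := D w))
  increment_sqr_integrable.
apply: (cvgr_to_le (cvgD _)) => [N w|].
  rewrite ger0_norm; last by apply: sumr_ge0 => i _; exact: sqr_ge0.
  exact: (bessel hip c1 c2).
apply: nearW => N; rewrite meanE -mulr_sumr ler_wpM2l ?subr_ge0 ?(ltW st)//.
have := c4 (fun u => (ip (Q u) u)%:E) N.
rewrite linear0r sumEFin => traceN; rewrite -lee_fin fineK.
  by apply: traceN => // u; rewrite lee_fin.
by rewrite ge0_fin_numE// esum_ge0// => u _; rewrite lee_fin.
Qed.

End levy_increment.

(** * Rational functions of the discrete operator in its eigenbasis *)

Section rational_functions.
Variables (R : realType) (H : normedModType R) (ip : {dot H for idfun}).
Hypothesis hip : induces_norm ip.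
Variables (n : nat) (lam : 'I_n.+1 -> R) (e : 'I_n.+1 -> H).
Hypothesis he : forall k l, ip (e k) (e l) = (k == l)%:R.

Let e_orth k l : k != l -> ip (e k) (e l) = 0.
Proof. by move=> kl; rewrite he (negbTE kl). Qed.
Let e_unit k : ip (e k) (e k) = 1.
Proof. by rewrite he eqxx. Qed.
Let e_norm k : e k = 0 \/ ip (e k) (e k) = 1.
Proof. by right. Qed.

Lemma ip_eigenbasis (a : 'I_n.+1 -> R) k : ip (\sum_i a i *: e i) (e k) = a k.
Proof. by rewrite ip_family// e_unit mulr1. Qed.

Lemma eigenbasis_parseval (a : 'I_n.+1 -> R) :
  `|\sum_i a i *: e i| ^+ 2 = \sum_i a i ^+ 2.
Proof.
by rewrite (norm_family hip e_orth); apply: eq_bigr => i _; rewrite e_unit mulr1.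
Qed.

Lemma span_expansion x : lin_span (range e) x -> x = \sum_k ip x (e k) *: e k.
Proof.
move=> [N [a [u [ue ->]]]].
have ueP i : exists k, e k = u i by have [k _ ke] := ue i; exists k.
have [f uE] := choice ueP.
have -> : \sum_(i < N) a i *: u i = \sum_k (\sum_(i | f i == k) a i) *: e k.
  rewrite (partition_big f xpredT)//=; apply: eq_bigr => k _.
  by rewrite scaler_suml; apply: eq_bigr => i /eqP <-; rewrite uE.
by apply: eq_bigr => k _; rewrite ip_eigenbasis.
Qed.

Variables (dt : R) (p q : {poly R}).

Lemma ip_ratop v k : ip (ratop ip lam e dt p q v) (e k) =
  p.[- (dt * lam k)] / q.[- (dt * lam k)] * ip v (e k).
Proof. exact: ip_eigenbasis. Qed.

(** The operator is diagonal in [e]. Since [v] ranges over all of [H], its component orthogonal to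
    the span is split off by Bessel's identity and dropped. *)
Lemma norm_ratop m v :
  (forall k, `|p.[- (dt * lam k)] / q.[- (dt * lam k)]| <= m) ->
  `|ratop ip lam e dt p q v| <= m * `|v|.
Proof.
move=> hm; have m0 : 0 <= m := le_trans (normr_ge0 _) (hm ord0).
rewrite -ler_sqr ?nnegrE ?mulr_ge0// eigenbasis_parseval exprMn.
rewrite (bessel_eq hip e_orth e_norm v) mulrDr.
apply: ler_wpDl; first by rewrite mulr_ge0 ?sqr_ge0.
rewrite mulr_sumr; apply: ler_sum => k _.
by rewrite exprMn ler_wpM2r ?sqr_ge0// -real_normK ?num_real// ler_sqr ?nnegrE.
Qed.

(** Used to erase [Ph] inside [ratop], because [Ph v] and [v] have the same coordinates. *)
Lemma eq_ratop v w : (forall k, ip v (e k) = ip w (e k)) ->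
  ratop ip lam e dt p q v = ratop ip lam e dt p q w.
Proof. by move=> vw; apply: eq_bigr => k _; rewrite vw. Qed.

End rational_functions.

(** * Mean-square estimates for a general rational scheme *)

Section galerkin_scheme.
Context (R : realType) d (T : measurableType d) (P : probability T R).
Variables (Fil : R -> set (set T)) (H U : normedModType R).
Variables (ipH : {dot H for idfun}) (ipU : {dot U for idfun}).
Variables (F : {linear H -> H}) (G : {bilinear H -> U -> H}).
Variables (Q : U -> U) (L : R -> T -> U) (b : set U).
Hypothesis hFil : is_filtration Fil.
Hypothesis hipH : induces_norm ipH.
Hypothesis hipU : induces_norm ipU.
Hypothesis sepU : separable_space U.
Hypothesis hF : continuous F.
Hypothesis hG : bounded_into_operators G.
Hypothesis hQpos : pos_semidef ipU Q.
Hypothesis hb : orthonormal_basis ipU b.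
Hypothesis hQtr : trace_class ipU b Q.
Hypothesis hL : is_Q_levy_martingale P ipU Fil L Q.
Variables (V : set H) (Ph : H -> H).
Hypothesis hPh : is_orth_proj ipH V Ph.
Variables (n : nat) (lam : 'I_n.+1 -> R) (e : 'I_n.+1 -> H).
Hypothesis he : forall k l, ipH (e k) (e l) = (k == l)%:R.
Hypothesis hV : V = lin_span (range e).
Variables (dt : R) (rn rd : {poly R}) (m M : R).
Hypothesis hm : forall k, `|rn.[- (dt * lam k)] / rd.[- (dt * lam k)]| <= m.
Hypothesis hM :
  forall k, `|(1 : {poly R}).[- (dt * lam k)] / rd.[- (dt * lam k)]| <= M.
Hypothesis hdt : 0 < dt.

Let m0 : 0 <= m := le_trans (normr_ge0 _) (hm ord0).
Let M0 : 0 <= M := le_trans (normr_ge0 _) (hM ord0).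

Lemma range_subset_span k : V (e k).
Proof.
rewrite hV; exists 1%N, (fun=> 1), (fun=> e k); split; first by move=> _; exists k.
by rewrite big_ord1 scale1r.
Qed.

Let drift x := ratop ipH lam e dt rn rd x
  + ratop ipH lam e dt 1 rd (dt *: Ph (F x)).
Let noise x u := ratop ipH lam e dt 1 rd (Ph (G x u)).

Let alpha := m + dt * (M * opnorm F).

Let ip_Ph v k : ipH (Ph v) (e k) = ipH v (e k).
Proof.
have /eqP := (hPh v).2 _ (range_subset_span k).
by rewrite linearBl subr_eq0 => /eqP.
Qed.

Let noiseE x u : noise x u = ratop ipH lam e dt 1 rd (G x u).
Proof. by apply: eq_ratop => k; exact: ip_Ph. Qed.

Let driftE x :
  drift x = ratop ipH lam e dt rn rd x + ratop ipH lam e dt 1 rd (dt *: F x).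
Proof.
congr (_ + _); apply: eq_ratop => k.
by rewrite !ip_scalel ip_Ph.
Qed.

Let norm_drift x : `|drift x| <= alpha * `|x|.
Proof.
rewrite driftE; apply: le_trans (ler_normD _ _) _; rewrite mulrDl.
apply: lerD; first exact: norm_ratop.
apply: le_trans (norm_ratop hipH he _ hM) _.
rewrite normrZ (gtr0_norm hdt) mulrCA -mulrA ler_wpM2l ?(ltW hdt)//.
by rewrite -mulrA ler_wpM2l// le_opnorm.
Qed.

Let norm_noise x u : `|noise x u| <= M * (opnorm2 G * `|x| * `|u|).
Proof.
rewrite noiseE; apply: le_trans (norm_ratop hipH he _ hM) _.
by rewrite ler_wpM2l// le_opnorm2.
Qed.

(** The matrix entries of the noise coefficient; packed below as continuous linear functionals on
    [U], so that the results on functionals of increments apply. *)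
Let Gfun k l (u : U) : R^o := ipH (G (e k) u) (e l).
Let Gfun_linear k l : linear (Gfun k l).
Proof.
by move=> a u v; rewrite /Gfun linearPr linearPl.
Qed.
Let Gphi k l : {linear U -> R^o} :=
  HB.pack (Gfun k l) (GRing.isLinear.Build _ _ _ _ (Gfun k l) (@Gfun_linear k l)).
Let Gphi_continuous k l : continuous (Gphi k l).
Proof.
move=> u; apply: (@continuous_comp _ _ _ (G (e k)) (fun v => ipH v (e l))).
  exact: (hG.1 (e k)).
exact: (ip_continuous hipH).
Qed.

(** * One step of the scheme from an adapted state [X] *)

Section step.
Variables (s : R) (X : T -> H).
Hypothesis s0 : 0 <= s.
Hypothesis X_adapted : forall k, real_meas_wrt (Fil s) (fun w => ipH (X w) (e k)).
Hypothesis X_span : forall w, X w = \sum_k ipH (X w) (e k) *: e k.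
Hypothesis X_int : P.-integrable setT (EFin \o (fun w => `|X w| ^+ 2)).

Let t := s + dt.
Let st : s < t. Proof. by rewrite ltrDl. Qed.
Let D w := L t w - L s w.
Let Y w := drift (X w) + noise (X w) (D w).
Let sub_meas r : 0 <= r -> Fil r `<=` measurable := fun r0 => (hFil.1 r r0).2.
Let sigma_Fil r : 0 <= r -> sigma_algebra setT (Fil r) := fun r0 => (hFil.1 r r0).1.
Let t0 : 0 <= t := ltW (le_lt_trans s0 st).

Let dc k := rn.[- (dt * lam k)] / rd.[- (dt * lam k)].
Let nc k := (1 : {poly R}).[- (dt * lam k)] / rd.[- (dt * lam k)].

(** Expressing the drift through the coordinates of [X] reduces its adaptedness to finite sums of
    adapted real functions. *)
Let ip_drift w k : ipH (drift (X w)) (e k) = dc k * ipH (X w) (e k)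
  + \sum_l nc k * dt * ipH (F (e l)) (e k) * ipH (X w) (e l).
Proof.
rewrite driftE ip_addl !(ip_ratop (ip := ipH))// ip_scalel; congr (_ + _).
rewrite {1}X_span linear_sum ip_suml !mulr_sumr; apply: eq_bigr => l _.
by rewrite [F _]linearZ /= ip_scalel /nc; ring.
Qed.

(** Bilinearity separates past from future: each term is a coordinate of [X] times a functional of
    the increment. *)
Let ip_noise w k : ipH (noise (X w) (D w)) (e k) =
  \sum_l nc k * ipH (X w) (e l) * Gphi l k (D w).
Proof.
rewrite noiseE (ip_ratop (ip := ipH))// {1}X_span linear_sumlz ip_suml mulr_sumr.
apply: eq_bigr => l _.
by rewrite [G _ _]linearZl_LR /= ip_scalel /nc /= /Gfun; ring.
Qed.

Let drift_adapted k : real_meas_wrt (Fil s) (fun w => ipH (drift (X w)) (e k)).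
Proof.
under eq_fun do rewrite ip_drift.
apply: real_meas_wrtD;
  [exact: sigma_Fil| |apply: real_meas_wrt_sum; first exact: sigma_Fil].
  by apply: real_meas_wrtM;
    [exact: sigma_Fil|apply: real_meas_wrt_cst; exact: sigma_Fil|].
by move=> l; apply: real_meas_wrtM;
    [exact: sigma_Fil|apply: real_meas_wrt_cst; exact: sigma_Fil|].
Qed.

Lemma scheme_step_adapted k : real_meas_wrt (Fil t) (fun w => ipH (Y w) (e k)).
Proof.
have lift f : real_meas_wrt (Fil s) f -> real_meas_wrt (Fil t) f.
  by move=> fs B mB; apply: (hFil.2 s t s0 (ltW st)); exact: fs.
under eq_fun do rewrite ip_addl ip_noise.
apply: real_meas_wrtD; [exact: sigma_Fil|exact/lift/drift_adapted|].
apply: real_meas_wrt_sum; [exact: sigma_Fil|move=> l].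
apply: real_meas_wrtM; [exact: sigma_Fil| |].
  apply: real_meas_wrtM;
    [exact: sigma_Fil|apply: real_meas_wrt_cst; exact: sigma_Fil|exact: lift].
exact: (functional_increment_adapted hFil hL s0 st (Gphi_continuous (k := l) (l := k))).
Qed.

Lemma scheme_step_span w : Y w = \sum_k ipH (Y w) (e k) *: e k.
Proof.
rewrite {1}/Y driftE noiseE /ratop -!big_split /=; apply: eq_bigr => k _.
rewrite -!scalerDl /Y driftE noiseE !ip_addl !(ip_ratop (ip := ipH))//.
Qed.

Let norm_X_adapted : real_meas_wrt (Fil s) (fun w => `|X w| ^+ 2).
Proof.
under eq_fun do rewrite X_span (eigenbasis_parseval hipH)//.
apply: real_meas_wrt_sum; [exact: sigma_Fil|move=> k].
under eq_fun do rewrite expr2.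
by apply: real_meas_wrtM; [exact: sigma_Fil|..].
Qed.

Let norm_sqr_indep :
  P.-integrable setT (EFin \o (fun w => `|X w| ^+ 2 * `|D w| ^+ 2)) /\
  \int[P]_w (`|X w| ^+ 2 * `|D w| ^+ 2) =
  \int[P]_w (`|X w| ^+ 2) * \int[P]_w (`|D w| ^+ 2).
Proof.
apply: (independent_expectationM (sub_meas s0)) => //.
- exact: (increment_norm_measurable hFil hipU sepU hb hL s0 st).
- move=> A B sA mB.
  exact: (increment_indep hL s0 st (@norm_sqr_continuous _ U) sA mB).
- exact: (increment_sqr_integrable hFil hipU sepU hb hL s0 st).
Qed.

Lemma scheme_step_norm_measurable : measurable_fun setT (fun w => `|Y w| ^+ 2).
Proof.
under eq_fun do rewrite scheme_step_span (eigenbasis_parseval hipH)//.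
apply: measurable_sum => k; apply: measurable_funX.
exact: (real_meas_wrt_measurable (sub_meas t0) (scheme_step_adapted k)).
Qed.

Let cross w := ipH (drift (X w)) (noise (X w) (D w)).

Let crossE w : cross w = \sum_k \sum_l
  nc k * (ipH (drift (X w)) (e k) * ipH (X w) (e l) * Gphi l k (D w)).
Proof.
rewrite /cross [X in ipH _ X](_ : _ =
  \sum_k ipH (noise (X w) (D w)) (e k) *: e k).
  rewrite ip_sym ip_suml; apply: eq_bigr => k _.
  rewrite ip_scalel [ipH (e k) _]ip_sym ip_noise mulr_suml.
  by apply: eq_bigr => l _; ring.
by rewrite {1}noiseE; apply: eq_bigr => k _; rewrite noiseE (ip_ratop (ip := ipH)).
Qed.

(** The first two factors are [Fil s]-measurable with product at most [alpha |X|^2], hence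
    integrable; the third is independent of [Fil s] and centred. *)
Let cross_term k l :
  P.-integrable setT (EFin \o (fun w =>
    ipH (drift (X w)) (e k) * ipH (X w) (e l) * Gphi l k (D w))) /\
  \int[P]_w (ipH (drift (X w)) (e k) * ipH (X w) (e l) * Gphi l k (D w)) = 0.
Proof.
have cG := Gphi_continuous (k := l) (l := k).
have fs : real_meas_wrt (Fil s) (fun w => ipH (drift (X w)) (e k) * ipH (X w) (e l)).
  by apply: real_meas_wrtM; [exact: sigma_Fil|exact: drift_adapted|].
have e1 i : `|e i| = 1.
  by apply/eqP; rewrite -sqrp_eq1// hipH he eqxx.
have fi : P.-integrable setT
    (EFin \o (fun w => ipH (drift (X w)) (e k) * ipH (X w) (e l))).
  apply: (integrable_dominated _ (g := fun w => alpha * `|X w| ^+ 2)).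
  - exact: (real_meas_wrt_measurable (sub_meas s0) fs).
  - exact: integrable_scaleR.
  - move=> w; rewrite normrM expr2 mulrA; apply: ler_pM => //.
      apply: le_trans (cauchy_schwarz hipH _ _) _.
      by rewrite e1 mulr1; exact: norm_drift.
    by apply: le_trans (cauchy_schwarz hipH _ _) _; rewrite e1 mulr1.
have [i1 i2] := independent_expectationM (sub_meas s0) fs
  (real_meas_wrt_measurable (sub_meas t0)
     (functional_increment_adapted hFil hL s0 st cG))
  (fun A B sA mB => increment_indep hL s0 st cG sA mB) fi
  (functional_increment_integrable hFil hipU sepU hb hL s0 st cG).
split; first exact: i1.
rewrite [LHS]i2 (_ : \int[P]_w _ w = 0) ?mulr0//.
exact: (functional_increment_mean hFil hipU sepU hb hL s0 st cG).
Qed.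

Let cross_int : P.-integrable setT (EFin \o cross).
Proof.
rewrite (funext crossE).
apply: integrable_sumR => k; apply: integrable_sumR => l.
by apply: integrable_scaleR; exact: (cross_term k l).1.
Qed.

Let cross_mean : \int[P]_w cross w = 0.
Proof.
under eq_Rintegral do rewrite crossE.
rewrite Rintegral_sum; last first.
  by move=> k; apply: integrable_sumR => l; apply: integrable_scaleR; exact: (cross_term k l).1.
apply: big1 => k _; rewrite Rintegral_sum; last first.
  by move=> l; apply: integrable_scaleR; exact: (cross_term k l).1.
apply: big1 => l _; rewrite RintegralZl//; last exact: (cross_term k l).1.
by rewrite (cross_term k l).2 mulr0.
Qed.

(** Only the two squares are estimated; the cross term is kept exactly, since it vanishes in the
    mean. *)
Let norm_Y w : `|Y w| ^+ 2 <= alpha ^+ 2 * `|X w| ^+ 2 + 2 * cross w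
  + (M * opnorm2 G) ^+ 2 * (`|X w| ^+ 2 * `|D w| ^+ 2).
Proof.
rewrite /Y (normD_sqr hipH); apply: lerD; first (apply: lerD => //).
  by rewrite -exprMn; apply: lerXn2r; rewrite ?nnegrE// (le_trans _ (norm_drift _)).
rewrite -!exprMn; apply: lerXn2r; rewrite ?nnegrE//.
  by rewrite !mulr_ge0// opnorm2_ge0.
by apply: le_trans (norm_noise _ _) _; rewrite !mulrA.
Qed.

Let bound_int : P.-integrable setT (EFin \o (fun w =>
  alpha ^+ 2 * `|X w| ^+ 2 + 2 * cross w
  + (M * opnorm2 G) ^+ 2 * (`|X w| ^+ 2 * `|D w| ^+ 2))).
Proof.
apply: integrable_addR; last exact: (integrable_scaleR _ norm_sqr_indep.1).
by apply: integrable_addR; apply: integrable_scaleR.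
Qed.

Lemma scheme_step_integrable :
  P.-integrable setT (EFin \o (fun w => `|Y w| ^+ 2)).
Proof.
apply: (integrable_dominated scheme_step_norm_measurable bound_int) => w.
by rewrite ger0_norm ?sqr_ge0//; exact: norm_Y.
Qed.

Lemma scheme_step_contraction : \int[P]_w (`|Y w| ^+ 2) <=
  (alpha ^+ 2 + dt * (trace ipU b Q * opnorm2 G ^+ 2 * M ^+ 2))
  * \int[P]_w (`|X w| ^+ 2).
Proof.
apply: le_trans (le_Rintegral measurableT scheme_step_integrable bound_int
  (fun w _ => norm_Y w)) _.
rewrite RintegralD//; last 2 first.
- by apply: integrable_addR; apply: integrable_scaleR.
- exact: (integrable_scaleR _ norm_sqr_indep.1).
rewrite RintegralD//; try exact: integrable_scaleR.
rewrite !RintegralZl//; last exact: norm_sqr_indep.1.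
rewrite cross_mean mulr0 addr0 mulrDl lerD2l norm_sqr_indep.2.
have hD : \int[P]_w (`|D w| ^+ 2) <= dt * trace ipU b Q.
  have tsE : t - s = dt by rewrite /t addrC addKr.
  rewrite -[X in _ <= X * _]tsE.
  exact: (increment_sqr_mean hFil hipU sepU hQpos hb hQtr hL s0 st).
rewrite [leRHS](_ : _ = (M * opnorm2 G) ^+ 2 *
  (\int[P]_w (`|X w| ^+ 2) * (dt * trace ipU b Q))); last by ring.
rewrite ler_wpM2l ?sqr_ge0// ler_wpM2l//.
by apply: Rintegral_ge0 => w _; exact: sqr_ge0.
Qed.

End step.

(** * Iteration of the step and geometric decay *)

Let scheme := galerkin_euler_maruyama ipH lam e Ph F G L dt rn rd.

Let rho := alpha ^+ 2 + dt * (trace ipU b Q * opnorm2 G ^+ 2 * M ^+ 2).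

Let rho_ge0 : 0 <= rho.
Proof.
apply: addr_ge0; first exact: sqr_ge0.
apply: mulr_ge0; first exact: ltW.
do 2 (apply: mulr_ge0; last exact: sqr_ge0).
by apply/fine_ge0/esum_ge0 => u _; rewrite lee_fin.
Qed.

Let scheme0_norm X0 w : `|scheme X0 0%N w| ^+ 2 = \sum_k ipH (X0 w) (e k) ^+ 2.
Proof.
have hw : V (Ph (X0 w)) by exact: (hPh (X0 w)).1.
rewrite hV in hw; rewrite /scheme /= (span_expansion he hw).
by rewrite (eigenbasis_parseval hipH)//; apply: eq_bigr => k _; rewrite ip_Ph.
Qed.

(** The three clauses are the hypotheses on the state in a single step, taken at time [j dt]; each
    step reproduces them at [(j + 1) dt]. *)
Let scheme_inv X0 j : in_L2 P (Fil 0) X0 ->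
  [/\ forall k, real_meas_wrt (Fil (j%:R * dt)) (fun w => ipH (scheme X0 j w) (e k)),
      forall w, scheme X0 j w = \sum_k ipH (scheme X0 j w) (e k) *: e k
    & P.-integrable setT (EFin \o (fun w => `|scheme X0 j w| ^+ 2))].
Proof.
move=> [X0_meas X0_L2]; have m0F : Fil 0 `<=` measurable := (hFil.1 0 (lexx 0)).2.
have ip_X0 k : real_meas_wrt (Fil 0) (fun w => ipH (X0 w) (e k)).
  by apply: (meas_wrt_comp (phi := fun v => ipH v (e k)) X0_meas); exact: ip_continuous.
elim: j => [|j [IH1 IH2 IH3]].
  rewrite mul0r; split.
  - by move=> k; rewrite /scheme /=; under eq_fun do rewrite ip_Ph; exact: ip_X0.
  - move=> w; apply: (span_expansion he); rewrite -hV; exact: (hPh _).1.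
  - have X0_int : P.-integrable setT (EFin \o (fun w => `|X0 w| ^+ 2)).
      apply: integrable_second_moment => //; apply: (real_meas_wrt_measurable m0F).
      exact: (meas_wrt_comp X0_meas (@norm_sqr_continuous _ H)).
    (* By Bessel the projected initial value has norm at most that of [X0]. *)
    apply: (integrable_dominated _ X0_int) => [|w].
      under eq_fun do rewrite scheme0_norm.
      apply: measurable_sum => k; apply: measurable_funX.
      exact: (real_meas_wrt_measurable m0F (ip_X0 k)).
    rewrite ger0_norm ?sqr_ge0// scheme0_norm.
    rewrite (bessel_eq hipH (c := e)) ?lerDr ?sqr_ge0//.
      by move=> k l kl; rewrite he (negbTE kl).
    by move=> k; right; rewrite he eqxx.
have jS : j.+1%:R * dt = j%:R * dt + dt by rewrite -natr1 mulrDl mul1r.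
have jdt : 0 <= j%:R * dt by rewrite mulr_ge0 ?(ltW hdt).
rewrite /scheme /= jS; split.
- exact: scheme_step_adapted.
- exact: scheme_step_span.
- exact: scheme_step_integrable.
Qed.

Let scheme_contraction X0 j : in_L2 P (Fil 0) X0 ->
  \int[P]_w (`|scheme X0 j.+1 w| ^+ 2) <= rho * \int[P]_w (`|scheme X0 j w| ^+ 2).
Proof.
move=> hX0; have [IH1 IH2 IH3] := scheme_inv j hX0.
have jS : j.+1%:R * dt = j%:R * dt + dt by rewrite -natr1 mulrDl mul1r.
have jdt : 0 <= j%:R * dt by rewrite mulr_ge0 ?(ltW hdt).
rewrite /scheme /= jS; exact: scheme_step_contraction.
Qed.

Let scheme_decay X0 j : in_L2 P (Fil 0) X0 ->
  \int[P]_w (`|scheme X0 j w| ^+ 2) <= rho ^+ j * \int[P]_w (`|scheme X0 0%N w| ^+ 2).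
Proof.
move=> hX0; elim: j => [|j IH]; first by rewrite expr0 mul1r.
apply: le_trans (scheme_contraction j hX0) _.
by rewrite exprS -mulrA ler_wpM2l.
Qed.

Lemma galerkin_scheme_stable :
  (m + dt * (M * opnorm F)) ^+ 2
    + dt * (trace ipU b Q * opnorm2 G ^+ 2 * M ^+ 2) < 1 ->
  asymptotically_mean_square_stable P (Fil 0) scheme.
Proof.
rewrite -/alpha -/rho => rho1.
have momentE X0 j : in_L2 P (Fil 0) X0 ->
    second_moment P (scheme X0 j) = (\int[P]_w (`|scheme X0 j w| ^+ 2))%:E.
  by move=> hX0; rewrite second_momentE//; have [] := scheme_inv j hX0.
have moment_ge0 X0 j : 0 <= \int[P]_w (`|scheme X0 j w| ^+ 2).
  by apply: Rintegral_ge0 => w _; exact: sqr_ge0.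
split.
  (* Since [rho < 1], no second moment exceeds the initial one, so [delta = eps] works. *)
  move=> eps eps0; exists eps => // X0 hX0 + j; rewrite !momentE// !lte_fin.
  apply: le_lt_trans; apply: le_trans (scheme_decay j hX0) _.
  by rewrite ler_piMl// exprn_ile1// ltW.
(* The decay holds for every initial value in [L^2]; the radius 1 is arbitrary. *)
exists 1 => // X0 hX0 _.
under eq_fun do rewrite momentE//.
apply: cvg_EFin; first exact: nearW.
apply: (@squeeze_cvgr _ _ _ _ (fun=> 0)
  (fun j => rho ^+ j * \int[P]_w (`|scheme X0 0%N w| ^+ 2))).
- by apply: nearW => j; rewrite moment_ge0 /=; exact: scheme_decay.
- exact: cvg_cst.
- rewrite -[X in _ --> X](mul0r (\int[P]_w (`|scheme X0 0%N w| ^+ 2))).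
  apply: cvgMl; apply: cvg_expr; rewrite ger0_norm//.
Qed.

End galerkin_scheme.

(** * Bounds at the eigenvalues for the three schemes *)

Lemma normr_le_max (R : realDomainType) (x y z : R) :
  x <= y -> y <= z -> `|y| <= Num.max `|x| `|z|.
Proof.
move=> xy yz; rewrite le_max; have [y0|y0] := leP 0 y.
  by rewrite (ger0_norm y0) (le_trans yz (ler_norm z)) orbT.
rewrite (ltr0_norm y0) -(normrN x) (le_trans _ (ler_norm (- x)))//.
by rewrite lerN2.
Qed.

Theorem theorem3p7 (R : realType)
  (* complete filtered probability space satisfying the usual conditions *)
  (d : measure_display) (T : measurableType d) (P : probability T R)
  (Fil : R -> set (set T))
  (hP : measure_is_complete P)
  (hFil : is_filtration Fil) (hUC : usual_conditions P Fil)
  (* the separable Hilbert spaces H and U *)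
  (H U : completeNormedModType R)
  (ipH : {dot H for idfun}) (ipU : {dot U for idfun})
  (hipH : induces_norm ipH) (hipU : induces_norm ipU)
  (hsepH : separable_space H) (hsepU : separable_space U)
  (* the operator -A *)
  (DA : set H) (negA : H -> H)
  (hAlin : linear_on DA negA) (hAdense : dense DA)
  (hAsa : self_adjoint_on ipH DA negA) (hApos : pos_def_on ipH DA negA)
  (hAinv : has_compact_inverse DA negA)
  (* F in L(H) and G in L(H; L(U; H)) *)
  (F : {linear H -> H}) (hF : continuous F)
  (G : {bilinear H -> U -> H}) (hG : bounded_into_operators G)
  (* the covariance operator Q, its trace and the Q-Levy process L *)
  (Q : {linear U -> U}) (hQ : continuous Q)
  (hQsa : self_adjoint ipU Q) (hQpos : pos_semidef ipU Q)
  (b : set U) (hb : orthonormal_basis ipU b) (hQtr : trace_class ipU b Q)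
  (L : R -> T -> U) (hL : is_Q_levy_martingale P ipU Fil L Q)
  (* (-A)^(1/2), with domain the space Hdot^1 *)
  (Hdot1 : set H) (sqrtA : H -> H)
  (hsqrt : is_sqrt_of ipH DA negA Hdot1 sqrtA)
  (* the Galerkin space V_h, P_h, -A_h and its spectral data *)
  (V : R -> set H) (h : R) (hh : 0 < h <= 1) (hV : V h `<=` Hdot1)
  (Ph : H -> H) (hPh : is_orth_proj ipH (V h) Ph)
  (negAh : H -> H) (hAh : is_galerkin_operator ipH sqrtA (V h) negAh)
  (n : nat) (lam : 'I_n.+1 -> R) (e : 'I_n.+1 -> H)
  (hlam : is_eigenbasis ipH (V h) negAh lam e)
  (dt : R) (hdt : 0 < dt) :
  let scheme (rn rd : {poly R}) :=
    galerkin_euler_maruyama ipH lam e Ph F G L dt rn rd in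
  let stable (rn rd : {poly R}) :=
    asymptotically_mean_square_stable P (Fil 0) (scheme rn rd) in
  let TrQ := trace ipU b Q in
  let nF := opnorm F in
  let nG := opnorm2 G in
  let lam1 := lam ord0 in
  let lamN := lam ord_max in
  [/\ (* backward Euler *)
      ((1 + dt * nF) ^+ 2 + dt * TrQ * nG ^+ 2) / (1 + dt * lam1) ^+ 2 < 1 ->
      stable 1 (1 - 'X),
      (* Crank--Nicolson *)
      (Num.max `|(1 - dt * lam1 / 2) / (1 + dt * lam1 / 2)|
               `|(1 - dt * lamN / 2) / (1 + dt * lamN / 2)|
         + dt * (nF / (1 + dt * lam1 / 2))) ^+ 2
        + dt * (TrQ * nG ^+ 2 / (1 + dt * lam1 / 2) ^+ 2) < 1 ->
      stable (1 + (1 / 2) *: 'X) (1 - (1 / 2) *: 'X)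
    & (* forward Euler *)
      (Num.max `|1 - dt * lam1| `|1 - dt * lamN| + dt * nF) ^+ 2
        + dt * TrQ * nG ^+ 2 < 1 ->
      stable (1 + 'X) 1].
Proof.
move=> scheme stable TrQ nF nG lam1 lamN.
have [hVspan he lam_mono hAe] := hlam.
have eV := range_subset_span hVspan.
(* Here [lam k = <negAh (e k), e k> = |sqrtA (e k)|^2]; this sign keeps the denominators of the
   implicit schemes positive. *)
have lam_ge0 k : 0 <= lam k.
  have := hAh.2 _ _ (eV k) (eV k).
  by rewrite hAe ip_scalel he eqxx mulr1 -hipH => ->; rewrite sqr_ge0.
have lam1_le k : lam1 <= lam k by exact: lam_mono.
have lamN_ge k : lam k <= lamN by apply: lam_mono; exact: leq_ord.
have stableI rn rd m M := @galerkin_scheme_stable R d T P Fil H U ipH ipU F G Q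
  L b hFil hipH hipU hsepU hF hG hQpos hb hQtr hL (V h) Ph hPh n lam e he hVspan
  dt rn rd m M.
have dl0 k : 0 <= dt * lam k by rewrite mulr_ge0// ltW.
have dl1 k : dt * lam1 <= dt * lam k by rewrite ler_wpM2l// ltW.
have dlN k : dt * lam k <= dt * lamN by rewrite ler_wpM2l// ltW.
have dl10 : 0 <= dt * lam1 := dl0 ord0.
have dlN0 : 0 <= dt * lamN := dl0 ord_max.
split=> hlt.
(* Backward Euler has [rn = 1], so this one bound serves as both [m] and [M]. *)
- have bound k : `|(1 : {poly R}).[- (dt * lam k)] / (1 - 'X).[- (dt * lam k)]| <=
      (1 + dt * lam1)^-1.
    rewrite !hornerE opprK ger0_norm ?invr_ge0 ?addr_ge0//.
    by rewrite lef_pV2 ?posrE ?ltr_wpDr// lerD2l.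
  apply: (stableI _ _ _ _ bound bound hdt).
  rewrite -/nF -/nG -/TrQ; apply: le_lt_trans hlt; rewrite le_eqVlt; apply/orP; left.
  by apply/eqP; field; rewrite gt_eqF// ltr_wpDr.
- have bound k : `|(1 : {poly R}).[- (dt * lam k)] /
      (1 - (1 / 2) *: 'X).[- (dt * lam k)]| <= (1 + dt * lam1 / 2)^-1.
    rewrite !hornerE (_ : 1 - _ = 1 + dt * lam k / 2); last by field.
    have := dl0 k; have := dl1 k => h1 h2.
    rewrite ger0_norm ?invr_ge0; last by lra.
    by rewrite lef_pV2 ?posrE; lra.
  have bound' k : `|(1 + (1 / 2) *: 'X).[- (dt * lam k)] /
      (1 - (1 / 2) *: 'X).[- (dt * lam k)]| <=
      Num.max `|(1 - dt * lam1 / 2) / (1 + dt * lam1 / 2)|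
              `|(1 - dt * lamN / 2) / (1 + dt * lamN / 2)|.
    rewrite !hornerE (_ : 1 - _ = 1 + dt * lam k / 2); last by field.
        rewrite (_ : 1 + 2^-1 * _ = 1 - dt * lam k / 2); last by field.
    (* The values decrease in the eigenvalue, so the lower endpoint comes from [lamN]. *)
    rewrite maxC.
    have mono (x y : R) : 0 <= x -> x <= y ->
        (1 - y / 2) / (1 + y / 2) <= (1 - x / 2) / (1 + x / 2).
      move=> x0 xy; rewrite ler_pdivrMr; last by lra.
      rewrite mulrAC ler_pdivlMr; last by lra.
      nra.
    (* Monotonicity puts the value at [lam k] between those at the extreme eigenvalues, which is why
       a maximum over two indices suffices. *)
    by apply: normr_le_max; apply: mono.
  apply: (stableI _ _ _ _ bound' bound hdt).
  rewrite -/nF -/nG -/TrQ; apply: le_lt_trans hlt; rewrite le_eqVlt; apply/orP; left.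
  apply/eqP; congr (_ ^+ 2 + dt * _); first by congr (_ + dt * _); rewrite mulrC.
  by rewrite exprVn.
(* Forward Euler has [rd = 1], hence [M = 1]; the amplification factor is affine and decreasing in
   the eigenvalue. *)
- have bound k : `|(1 : {poly R}).[- (dt * lam k)] /
      (1 : {poly R}).[- (dt * lam k)]| <= 1.
    by rewrite !hornerE invr1 normr1.
  have bound' k : `|(1 + 'X).[- (dt * lam k)] / (1 : {poly R}).[- (dt * lam k)]| <=
      Num.max `|1 - dt * lam1| `|1 - dt * lamN|.
    rewrite !hornerE invr1 mulr1 maxC.
    by apply: normr_le_max; rewrite lerD2l lerN2.
  apply: (stableI _ _ _ _ bound' bound hdt).
  by rewrite -/nF -/nG -/TrQ mul1r expr1n mulr1 mulrA.
Qed.
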